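(* Let $k\geq 2$, $q\ge1$ be integers and $\mathcal{A}$ as in the context. For the type-$\mathcal{A}$ random walk on $\mathbb{Z}^k$, let $\overline{R}_{n,k}=\frac1n(X_1X_2+X_2X_3+\cdots+X_nX_{n+1})$. Then $$\lim_{n\to\infty}\overline{R}_{n,k}=\prod_p\Big(1-\frac{2}{p^k}\Big)$$ almost surely, where $p$ runs over all primes.
   Context: $\mathcal{A}=\{\boldsymbol{\alpha}_1,\dots,\boldsymbol{\alpha}_q\}$ is a finite set of vectors $\boldsymbol{\alpha}_t=(\alpha_{t,1},\dots,\alpha_{t,k})$ with $0<\alpha_{t,j}<1$ for all $j$ and $\alpha_{t,1}+\cdots+\alpha_{t,k}=1$. For $\boldsymbol{\alpha}=(\alpha_1,\dots,\alpha_k)$ of this form, a type-$\boldsymbol{\alpha}$ step $\mathbf{w}(\boldsymbol{\alpha})$ is a random vector equal to the $j$-th standard basis vector of $\mathbb{Z}^k$ with probability $\alpha_j$. The type-$\mathcal{A}$ random walk is $\mathbf{p}_0=(0,\dots,0)$, $\mathbf{p}_i=\mathbf{p}_{i-1}+\mathbf{w}(\boldsymbol{\alpha}'_i)$ for $i\ge1$, where at each step a type $\boldsymbol{\alpha}'_i\in\mathcal{A}$ is chosen and the steps are independent. A lattice point $\mathbf{n}=(n_1,\dots,n_k)\in\mathbb{Z}^k$ is visible if there is no other lattice point on the segment joining it to the origin (equivalently $\gcd(n_1,\dots,n_k)=1$). $X_i=1$ if $\mathbf{p}_i$ is visible and $X_i=0$ otherwise. *)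

(* Defs.v *)
From HB Require Import structures.
From mathcomp Require Import all_boot all_order all_algebra.
From mathcomp Require Import all_classical all_reals all_analysis.
Set Implicit Arguments. Unset Strict Implicit. Unset Printing Implicit Defensive.
Import Order.TTheory GRing.Theory Num.Theory.
Import numFieldNormedType.Exports.
Local Open Scope ring_scope.
Local Open Scope classical_set_scope.

(* A step is encoded by the index j : 'I_k of the standard basis vector e_j.
   Position after n steps (steps W 0, ..., W (n-1)): coordinate j counts how
   many of these steps equal e_j.  Coordinates are nonnegative. *)
Definition walk_pos (T : Type) (k : nat) (W : nat -> T -> 'I_k) (n : nat) (t : T)
  : 'I_k -> nat := fun j => (\sum_(i < n) (W i t == j))%N.

Definition visible (k : nat) (v : 'I_k -> nat) : bool :=
  (\big[gcdn/0%N]_(j < k) v j) == 1%N.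

Definition Xvis (R : realType) (T : Type) (k : nat) (W : nat -> T -> 'I_k)
  (n : nat) (t : T) : R := (visible (walk_pos W n t))%:R.

Definition Rbar_avg (R : realType) (T : Type) (k : nat) (W : nat -> T -> 'I_k)
  (n : nat) (t : T) : R :=
  n%:R^-1 * \sum_(1 <= i < n.+1) (Xvis R W i t * Xvis R W i.+1 t).

Definition euler_prod (R : realType) (k : nat) : R :=
  lim ((fun N : nat => \prod_(0 <= p < N | prime p) (1 - 2 / (p%:R ^+ k) : R)) @ \oo).

(* Main.v *)
(* A position of the walk at time i has coordinate sum i, so only primes
   dividing i can divide it.

   Fix a cutoff M. Modulo the product L of the primes below M, the walk forgets
   its starting point exponentially fast (Doeblin), up to the constraint on the
   coordinate sum; by symmetry the average over L consecutive times of the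
   probability that two successive positions are free of primes below M is
   prod_(p < M) (1 - 2/p^k), by the Chinese remainder theorem, whatever the
   types of the steps.  Primes p >= M are negligible: Nash's inequality on Z/p
   bounds the probability that p divides a fixed coordinate after m steps by
   sqrt(2/p) + O(m^(-1/4)), uniformly in the start and the types, and a time
   i has only O(log i) prime divisors.

   Hence the score of a block of length j^10 within [0, j^20] has, conditionally
   on its past, mean close to j^10 * prod_p (1 - 2/p^k).  A second moment
   bound, block by block, and Chebyshev's inequality give a deviation probability
   O(j^-10) at time j^20; Borel-Cantelli and interpolation between consecutive
   powers j^20 conclude. *)
Require Import Defs.
From HB Require Import structures.
From mathcomp Require Import all_boot all_order all_algebra all_fingroup.
From mathcomp Require Import all_classical all_reals all_analysis.
From mathcomp Require Import ring lra zify.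
Set Implicit Arguments. Unset Strict Implicit. Unset Printing Implicit Defensive.
Import Order.TTheory GRing.Theory Num.Theory.
Import numFieldNormedType.Exports.

(** * Counting primitive pairs of residues *)

Section PairCount.
Variable k : nat.

Definition primitive_at (s : seq nat) (x : 'I_k -> nat) : bool :=
  all (fun p => ~~ [forall j, p %| x j]) s.

Variable j0 : 'I_k.

Definition primitive_pair (s : seq nat) (x : 'I_k -> nat) : bool :=
  primitive_at s x && primitive_at s (fun i => x i + (i == j0)).

Lemma primitive_at_mod s n x y : all (dvdn^~ n) s ->
  (forall i, x i = y i %[mod n]) -> primitive_at s x = primitive_at s y.
Proof.
move=> sn xy; apply: eq_in_all => p /(allP sn) pn; congr (~~ _).
apply: eq_forallb => i.
by rewrite /dvdn -(modn_dvdm (x i) pn) -(modn_dvdm (y i) pn) xy.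
Qed.

Lemma primitive_pair_mod s n x y : all (dvdn^~ n) s ->
  (forall i, x i = y i %[mod n]) -> primitive_pair s x = primitive_pair s y.
Proof.
move=> sn xy; congr (_ && _); apply: (primitive_at_mod sn) => // i.
by rewrite -modnDml xy modnDml.
Qed.

Lemma primitive_pair_cons p s x :
  primitive_pair (p :: s) x = primitive_pair [:: p] x && primitive_pair s x.
Proof. by rewrite /primitive_pair /primitive_at /= !andbT andbACA. Qed.

(** Exactly two residue vectors fail: 0, where the first point is divisible by [p], and minus the
    basis vector [j0], where the second one is. *)
Lemma count_primitive_pair_prime p : prime p ->
  \sum_(v : {ffun 'I_k -> 'I_p}) primitive_pair [:: p] (fun i => v i) = p ^ k - 2.
Proof.
move=> pp; have p0 := prime_gt0 pp; have p1 := prime_gt1 pp.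
have pm : p.-1 < p by rewrite prednK.
pose z : {ffun 'I_k -> 'I_p} := [ffun=> Ordinal p0].
pose y : {ffun 'I_k -> 'I_p} := [ffun i => if i == j0 then Ordinal pm else Ordinal p0].
have zy : z != y.
  apply/eqP => /ffunP/(_ j0)/(congr1 val); rewrite !ffunE eqxx /= => E.
  by move: p1; rewrite -(prednK p0) -E.
have dvd_small a : a < p -> (p %| a) = (a == 0).
  by case: a => [|a] ap; rewrite ?dvdn0 // gtnNdvd.
have E (v : {ffun 'I_k -> 'I_p}) :
    primitive_pair [:: p] (fun i => v i) = (v \notin [set z; y]).
  rewrite /primitive_pair /primitive_at /= !andbT !inE negb_or.
  congr (~~ _ && ~~ _).
    apply/forallP/eqP => [vp|-> j]; last by rewrite ffunE dvdn0.
    apply/ffunP => j; apply/val_inj; rewrite ffunE /=.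
    by apply/eqP; rewrite -dvd_small.
  apply/forallP/eqP => [vp|-> j]; last first.
    by rewrite ffunE; case: (j == j0) => /=; rewrite ?addn1 ?prednK // dvdn0.
  apply/ffunP => j; apply/val_inj; rewrite ffunE.
  have := vp j; case: (j == j0) => /=; last first.
    by rewrite addn0 dvd_small // => /eqP.
  rewrite addn1 => pv; apply/eqP; rewrite -eqSS prednK //.
  by rewrite eqn_leq ltn_ord dvdn_leq.
under eq_bigr do rewrite E.
have -> : p ^ k = #|{ffun 'I_k -> 'I_p}| by rewrite card_ffun !card_ord.
rewrite -(cardsC [set z; y]) cards2 zy addKn -sum1_card [RHS]big_mkcond /=.
by apply: eq_bigr => v _; rewrite finset.in_setC; case: (v \notin _).
Qed.

Lemma coprime_prime_prod p s : prime p -> all prime s -> p \notin s ->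
  coprime p (\prod_(q <- s) q).
Proof.
move=> pp; elim: s => [|q s IH] /=; first by rewrite big_nil coprimen1.
case/andP=> pq ps; rewrite inE negb_or => /andP[npq nps].
by rewrite big_cons coprimeMr IH // andbT prime_coprime // dvdn_prime2.
Qed.

(** Induction on [s] by the Chinese remainder theorem: vectors modulo [p * m] correspond to pairs of
    vectors modulo [p] and modulo [m], and the condition splits accordingly. *)
Lemma count_primitive_pair s n : all prime s -> uniq s -> n = \prod_(p <- s) p ->
  \sum_(v : {ffun 'I_k -> 'I_n}) primitive_pair s (fun i => v i) =
  \prod_(p <- s) (p ^ k - 2).
Proof.
elim: s n => [|p s IH] n /=.
  by move=> _ _ ->; rewrite !big_nil sum_nat_const card_ffun !card_ord exp1n.
case/andP=> pp ps /andP[pns us]; rewrite !big_cons => nE.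
have p0 := prime_gt0 pp.
move: (coprime_prime_prod pp ps pns) nE (IH _ ps us erefl).
have : 0 < \prod_(q <- s) q.
  rewrite big_seq; apply: prodn_cond_gt0 => q qs.
  exact: prime_gt0 (allP ps q qs).
have : all (dvdn^~ (\prod_(q <- s) q)) s.
  by apply/allP => q qs; rewrite (big_rem q) //= dvdn_mulr.
move: (\prod_(q <- s) q) => m ms m0 pm -> {}IH.
pose f (v : {ffun 'I_k -> 'I_(p * m)}) : {ffun 'I_k -> 'I_p} * {ffun 'I_k -> 'I_m} :=
  ([ffun i => Ordinal (ltn_pmod (v i) p0)], [ffun i => Ordinal (ltn_pmod (v i) m0)]).
have f_inj : injective f.
  move=> u v [/ffunP E1 /ffunP E2]; apply/ffunP => i; apply/val_inj.
  have /(congr1 val) := E1 i; have /(congr1 val) := E2 i; rewrite !ffunE /=.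
  move=> e2 e1; rewrite -[LHS](modn_small (ltn_ord (u i))).
  rewrite -[RHS](modn_small (ltn_ord (v i))).
  by apply/eqP; rewrite chinese_remainder // e1 e2 !eqxx.
have f_bij : bijective f.
  apply: inj_card_bij => //.
  by rewrite card_prod !card_ffun !card_ord expnMn.
pose F1 (u : {ffun 'I_k -> 'I_p}) : nat := primitive_pair [:: p] (fun i => u i).
pose F2 (u : {ffun 'I_k -> 'I_m}) : nat := primitive_pair s (fun i => u i).
rewrite -(count_primitive_pair_prime pp) -IH.
transitivity (\sum_(x : {ffun 'I_k -> 'I_p} * {ffun 'I_k -> 'I_m}) F1 x.1 * F2 x.2).
  rewrite [RHS](reindex f) /=; last exact: onW_bij.
  apply: eq_bigr => v _; rewrite primitive_pair_cons /F1 /F2 -mulnb; congr (_ * _).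
    congr nat_of_bool; apply: (@primitive_pair_mod _ p); rewrite /= ?dvdnn // => i.
    by rewrite ffunE /= modn_mod.
  congr nat_of_bool; apply: (@primitive_pair_mod _ m) => // i.
  by rewrite ffunE /= modn_mod.
rewrite -(pair_bigA _ (fun u w => F1 u * F2 w)) /= big_distrl /=.
by apply: eq_bigr => u _; rewrite big_distrr.
Qed.

End PairCount.

(** * Prime divisors and multiples *)

Lemma prod_primes_dvd i s : all prime s -> uniq s -> all (dvdn^~ i) s ->
  \prod_(p <- s) p %| i.
Proof.
elim: s => [|p s IH] /=; first by rewrite big_nil dvd1n.
case/andP=> pp ps /andP[pns us] /andP[pi si]; rewrite big_cons.
by rewrite Gauss_dvd ?pi ?IH // coprime_prime_prod.
Qed.

Lemma exp2_size_primes i : 0 < i -> 2 ^ size (primes i) <= i.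
Proof.
move=> i0; apply: (@leq_trans (\prod_(p <- primes i) p)).
  have : all prime (primes i) by apply/allP => p; rewrite mem_primes => /and3P[].
  elim: (primes i) => [|p s IH] /=; first by rewrite big_nil.
  by case/andP=> pp ps; rewrite big_cons expnS leq_mul ?IH // prime_gt1.
apply: dvdn_leq => //; apply: prod_primes_dvd (primes_uniq i) _.
  by apply/allP => p; rewrite mem_primes => /and3P[].
by apply/allP => p; rewrite mem_primes => /and3P[].
Qed.

Lemma expn_le_exp2 r w : 0 < r -> w ^ r <= r ^ r * 2 ^ w.
Proof.
(* With [t = w %/ r], one has [w <= r * t.+1 <= r * 2 ^ t]. *)
move=> r0; apply: (@leq_trans ((r * 2 ^ (w %/ r)) ^ r)).
  rewrite leq_exp2r // {1}(divn_eq w r) mulnC.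
  apply: (@leq_trans (r * (w %/ r).+1)).
    by rewrite mulnS addnC leq_add2r ltnW // ltn_pmod.
  by rewrite leq_mul2l ltn_expl // orbT.
rewrite expnMn -expnM leq_mul2l; apply/orP; right.
by rewrite leq_pexp2l // leq_divM.
Qed.

(* A logarithmic bound on the number of prime divisors, in a form avoiding logarithms. *)
Lemma size_primes_le r j i : 0 < r -> 0 < i -> i <= j ^ r ->
  size (primes i) <= r * j.
Proof.
move=> r0 i0 ij; rewrite -(@leq_exp2r _ _ r) //.
apply: leq_trans (expn_le_exp2 _ r0) _; rewrite expnMn leq_mul2l.
by rewrite (leq_trans (exp2_size_primes i0) ij) orbT.
Qed.

Lemma count_multiples p a l : 0 < p ->
  \sum_(m < l) (p %| a + m.+1) = (a + l) %/ p - a %/ p.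
Proof.
move=> p0; elim: l => [|l IH]; first by rewrite big_ord0 addn0 subnn.
rewrite big_ord_recr /= IH addnS divnS // addnC addnBA //.
by rewrite leq_div2r // leq_addr.
Qed.

Local Open Scope ring_scope.

(** * Expectations along inhomogeneous chains *)

Section Expectation.
Variables (R : rcfType) (k : nat) (beta : nat -> 'I_k -> R).
Hypothesis beta_ge0 : forall i j, 0 <= beta i j.
Hypothesis beta_sum : forall i, \sum_j beta i j = 1.

(** The transition operator at time [i]. The state space is left arbitrary because the same random
    letters drive positions, residue vectors, a single coordinate, and positions paired with a
    score. *)
Definition avg_step (S : Type) (st : S -> 'I_k -> S) (i : nat) (f : S -> R)
  (s : S) : R := \sum_j beta i j * f (st s j).

(* The expectation of [f] at the state reached at time [a + m], given the state
   [s] at time [a]. *)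
Fixpoint expect (S : Type) (st : S -> 'I_k -> S) (a m : nat) (f : S -> R)
  (s : S) : R :=
  if m is m'.+1 then avg_step st a (expect st a.+1 m' f) s else f s.

Section OneChain.
Variables (S : Type) (st : S -> 'I_k -> S).
Implicit Types (f g : S -> R) (s : S).

Lemma expectS a m f s :
  expect st a m.+1 f s = \sum_j beta a j * expect st a.+1 m f (st s j).
Proof. by []. Qed.

Lemma expectD a m n f s :
  expect st a (m + n) f s = expect st a m (expect st (a + m) n f) s.
Proof.
elim: m a s => [|m IH] a s; first by rewrite addn0.
rewrite addSn !expectS; apply: eq_bigr => j _.
by rewrite IH addSnnS.
Qed.

Lemma expectS_last a m f s :
  expect st a m.+1 f s = expect st a m (avg_step st (a + m) f) s.
Proof. by rewrite -addn1 expectD. Qed.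

(** The invariant restricts the comparison to reachable states, for instance those whose coordinate
    sum equals the time. *)
Lemma expect_inv_le (I : nat -> S -> Prop) a m f g s :
  (forall i s j, I i s -> I i.+1 (st s j)) -> I a s ->
  (forall s', I (a + m)%N s' -> f s' <= g s') ->
  expect st a m f s <= expect st a m g s.
Proof.
move=> Ist; elim: m a s => [|m IH] a s Is fg.
  by apply: fg; rewrite addn0.
rewrite !expectS; apply: ler_sum => j _; apply: ler_wpM2l => //.
apply: IH => [|s' Is']; first exact: Ist.
by apply: fg; rewrite -addSnnS.
Qed.

Lemma expect_le a m f g s :
  (forall s', f s' <= g s') -> expect st a m f s <= expect st a m g s.
Proof. by move=> fg; apply: (@expect_inv_le (fun _ _ => True)). Qed.

Lemma expect_inv_eq (I : nat -> S -> Prop) a m f g s :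
  (forall i s j, I i s -> I i.+1 (st s j)) -> I a s ->
  (forall s', I (a + m)%N s' -> f s' = g s') ->
  expect st a m f s = expect st a m g s.
Proof.
by move=> Ist Is fg; apply: le_anti; apply/andP; split;
  apply: (expect_inv_le Ist Is) => s' Is'; rewrite fg.
Qed.

Lemma eq_expect a m f g s :
  (forall s', f s' = g s') -> expect st a m f s = expect st a m g s.
Proof. by move=> fg; apply: (@expect_inv_eq (fun _ _ => True)). Qed.

Lemma expect_cst a m x s : expect st a m (fun=> x) s = x.
Proof.
elim: m a s => [|m IH] a s //; rewrite expectS.
by under eq_bigr do rewrite IH; rewrite -mulr_suml beta_sum mul1r.
Qed.

Lemma expect_scale a m x f s :
  expect st a m (fun s' => x * f s') s = x * expect st a m f s.
Proof.
elim: m a s => [|m IH] a s //; rewrite !expectS mulr_sumr.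
by apply: eq_bigr => j _; rewrite IH mulrCA.
Qed.

Lemma expect_add a m f g s :
  expect st a m (fun s' => f s' + g s') s =
  expect st a m f s + expect st a m g s.
Proof.
elim: m a s => [|m IH] a s //; rewrite !expectS -big_split /=.
by apply: eq_bigr => j _; rewrite IH mulrDr.
Qed.

Lemma expect_sum (J : Type) (r : seq J) (Q : pred J) a m (F : J -> S -> R) s :
  expect st a m (fun s' => \sum_(i <- r | Q i) F i s') s =
  \sum_(i <- r | Q i) expect st a m (F i) s.
Proof.
elim: r => [|i r IH].
  by rewrite big_nil -[RHS](expect_cst a m 0 s); apply: eq_expect => s'; rewrite big_nil.
rewrite big_cons; case: ifP => Qi.
  rewrite -IH -expect_add; apply: eq_expect => s'.
  by rewrite big_cons Qi.
by rewrite -IH; apply: eq_expect => s'; rewrite big_cons Qi.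
Qed.

Lemma expect_ge0 a m f s : (forall s', 0 <= f s') -> 0 <= expect st a m f s.
Proof. by move=> f0; rewrite -(expect_cst a m 0 s); apply: expect_le. Qed.

Lemma expect_le1 a m f s : (forall s', f s' <= 1) -> expect st a m f s <= 1.
Proof. by move=> f1; rewrite -[leRHS](expect_cst a m 1 s); apply: expect_le. Qed.

End OneChain.

(** Projection of chains: it transfers expectations from positions to residues or to one
    coordinate. *)
Lemma expect_hom (S S' : Type) (st : S -> 'I_k -> S) (st' : S' -> 'I_k -> S')
    (h : S -> S') a m f s :
  (forall s j, h (st s j) = st' (h s) j) ->
  expect st a m (fun x => f (h x)) s = expect st' a m f (h s).
Proof.
move=> hst; elim: m a s => [|m IH] a s //; rewrite !expectS.
by apply: eq_bigr => j _; rewrite IH hst.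
Qed.

(** The word [w] is played with probability at least [c ^+ size w], and the other words contribute a
    nonnegative amount. This is the minorization behind the Doeblin argument. *)
Lemma expect_word_ge (S : Type) (st : S -> 'I_k -> S) (I : nat -> S -> Prop)
    (c : R) a w f s :
  0 <= c -> (forall i j, c <= beta i j) ->
  (forall i s j, I i s -> I i.+1 (st s j)) -> I a s ->
  (forall s', I (a + size w)%N s' -> 0 <= f s') ->
  c ^+ size w * f (foldl st s w) <= expect st a (size w) f s.
Proof.
move=> c0 cb Ist; elim: w a s => [|j w IH] a s Is f0 /=.
  by rewrite expr0 mul1r.
have f0' s' : I (a.+1 + size w)%N s' -> 0 <= f s'.
  by rewrite addSnnS; apply: f0.
have pos j' : 0 <= expect st a.+1 (size w) f (st s j').
  rewrite -(expect_cst st a.+1 (size w) 0 (st s j')).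
  by apply: (expect_inv_le Ist) => //; apply: Ist.
rewrite -/(avg_step st a _ s) /avg_step (bigD1 j) //= exprS -mulrA.
apply: ler_wpDr; first by apply: sumr_ge0 => j' _; apply: mulr_ge0.
apply: (@le_trans _ _ (c * expect st a.+1 (size w) f (st s j))).
  by apply: ler_wpM2l => //; apply: IH => //; apply: Ist.
by apply: ler_wpM2r.
Qed.

End Expectation.

(** * Anticoncentration *)

(** Functions on Z/p are encoded as functions on [nat] that agree at 0 and [p]. *)
Lemma sum_shift (V : zmodType) (p : nat) (g : nat -> V) :
  g p = g 0%N -> \sum_(y < p) g y.+1 = \sum_(y < p) g y.
Proof.
move=> gp; apply: (@addrI _ (g 0%N)).
rewrite -[LHS](big_ord_recl p (fun i => g (nat_of_ord i))).
by rewrite big_ord_recr /= gp addrC.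
Qed.

Lemma dist_le_variation (R : realDomainType) (p b : nat) (g : nat -> R) :
  (b <= p)%N -> `|g b - g 0%N| <= \sum_(y < p) `|g y.+1 - g y|.
Proof.
move=> bp; apply: (@le_trans _ _ (\sum_(y < b) `|g y.+1 - g y|)).
  elim: b {bp} => [|b IH]; first by rewrite subrr normr0 big_ord0.
  rewrite big_ord_recr /= addrC.
  have -> : g b.+1 - g 0%N = (g b.+1 - g b) + (g b - g 0%N) by ring.
  by apply: (le_trans (ler_normD _ _)); rewrite lerD2l.
rewrite -(subnKC bp) big_split_ord /= lerDl.
by apply: sumr_ge0.
Qed.

(** Here [s] is [a - b] up to sign, so that [s * (a + b)] can be the absolute difference of the
    squares. The two sides differ by a sum of two squares. *)
Lemma weighted_amgm (R : realFieldType) (a b s e : R) :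
  s ^+ 2 = (a - b) ^+ 2 ->
  s * (a + b) * e <= 8 * (a - b) ^+ 2 + e ^+ 2 / 16 * (a ^+ 2 + b ^+ 2).
Proof.
move=> sE; rewrite -subr_ge0 -sE.
have -> : a ^+ 2 + b ^+ 2 = ((a + b) ^+ 2 + s ^+ 2) / 2 by rewrite sE; field.
have -> : 8 * s ^+ 2 + e ^+ 2 / 16 * (((a + b) ^+ 2 + s ^+ 2) / 2) - s * (a + b) * e =
  8 * (s - e * (a + b) / 16) ^+ 2 + (e * s) ^+ 2 / 32 by field.
by apply: addr_ge0; [apply: mulr_ge0|apply: divr_ge0]; rewrite // sqr_ge0.
Qed.

Section Nash.
Variables (R : realFieldType) (p : nat).

Definition energy (f : nat -> R) := \sum_(y < p) f y ^+ 2.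
Definition dirichlet (f : nat -> R) := \sum_(y < p) (f y.+1 - f y) ^+ 2.

Lemma energy_ge0 f : 0 <= energy f.
Proof. by apply: sumr_ge0 => y _; rewrite sqr_ge0. Qed.

(* Nash: [energy f <= max f] because [f] has mass 1, while [max f ^+ 2] exceeds
   [min f ^+ 2 <= 1 / p ^+ 2] by at most twice the variation of [f ^+ 2], which AM-GM
   bounds by the Dirichlet form. *)
Lemma nash_inequality f : (0 < p)%N -> (forall y, 0 <= f y) -> f p = f 0%N ->
  \sum_(y < p) f y = 1 -> 2 / p%:R <= energy f ->
  energy f ^+ 3 / 32 <= dirichlet f.
Proof.
move=> p0 f0 fp f1 e2.
have pR : 0 < p%:R :> R by rewrite ltr0n.
have epos : 0 < energy f by apply: lt_le_trans e2; rewrite divr_gt0.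
set e := energy f in e2 epos *.
pose i0 : 'I_p := Ordinal p0.
case: (@Order.TotalTheory.arg_minP _ _ _ i0 xpredT (fun i : 'I_p => f i) isT) => z _ zmin.
case: (@Order.TotalTheory.arg_maxP _ _ _ i0 xpredT (fun i : 'I_p => f i) isT) => y _ ymax.
have fz : f z * p%:R <= 1.
  rewrite -[leRHS]f1 mulr_natr -[X in _ *+ X]card_ord -sumr_const.
  by apply: ler_sum => i _; apply: zmin.
have fy : e <= f y.
  rewrite -[f y]mulr1 -f1 mulr_sumr; apply: ler_sum => i _.
  by rewrite expr2 ler_wpM2r //; apply: ymax.
set V := \sum_(w < p) `|f w.+1 ^+ 2 - f w ^+ 2|.
have VD : V <= 8 / e * dirichlet f + e ^+ 2 / 8.
  have -> : e ^+ 2 / 8 = e / 16 * (\sum_(w < p) f w.+1 ^+ 2) + e / 16 * e.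
    by rewrite (sum_shift (g := fun w => f w ^+ 2)) ?fp // -/(energy f) -/e; field.
  rewrite {2}/e /energy /dirichlet !mulr_sumr -!big_split /=.
  apply: ler_sum => w _.
  set a := f w.+1; set b := f w.
  have a0 : 0 <= a by apply: f0.
  have b0 : 0 <= b by apply: f0.
  have sq t : 0 <= t ^+ 2 :> R := sqr_ge0 t.
  have -> : 8 / e * (a - b) ^+ 2 + (e / 16 * a ^+ 2 + e / 16 * b ^+ 2) =
    (8 * (a - b) ^+ 2 + e ^+ 2 / 16 * (a ^+ 2 + b ^+ 2)) / e.
    by field; rewrite gt_eqF.
  rewrite ler_pdivlMr //.
  have key s : s ^+ 2 = (a - b) ^+ 2 -> s * (a + b) * e <=
     8 * (a - b) ^+ 2 + e ^+ 2 / 16 * (a ^+ 2 + b ^+ 2).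
    by move=> E; apply: weighted_amgm.
  have [ab|ab] := lerP b a.
    rewrite ger0_norm; last by rewrite subr_ge0 ler_pXn2r.
    by rewrite subr_sqr; apply: key.
  rewrite ler0_norm; last by rewrite subr_le0 ler_pXn2r // ltW.
  rewrite opprB subr_sqr addrC (addrC b) addrC.
  by apply: key; ring.
(* The maximum and the minimum are both compared with the value at 0, whence the factor 2. *)
have fyz : f y ^+ 2 - f z ^+ 2 <= 2 * V.
  have hy := @dist_le_variation _ p y (fun w => f w ^+ 2) (ltnW (ltn_ord y)).
  have hz := @dist_le_variation _ p z (fun w => f w ^+ 2) (ltnW (ltn_ord z)).
  rewrite -/V /= in hy hz.
  move: hy hz; rewrite !ler_norml => /andP[_ h1] /andP[h2 _].
  lra.
have fz2 : f z <= e / 2.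
  rewrite ler_pdivlMr //; apply: le_trans e2.
  by rewrite ler_pdivlMr // mulrAC; have := fz; lra.
have e0 := ltW epos.
have fy2 : e ^+ 2 <= f y ^+ 2  by rewrite ler_pXn2r // nnegrE.
have fz3 : f z ^+ 2 <= (e / 2) ^+ 2.
  by rewrite ler_pXn2r // nnegrE ?f0 ?divr_ge0.
(* Chain: [e^2 <= f y^2 <= f z^2 + 2 V <= e^2 / 4 + (16 / e) * dirichlet f + e^2 / 4]. *)
have H : e ^+ 2 / 4 <= 8 / e * dirichlet f by nra.
rewrite -(ler_pM2l (_ : 0 < 8 / e)) ?divr_gt0 //; apply: le_trans H.
suff -> : 8 / e * (e ^+ 3 / 32) = e ^+ 2 / 4 by [].
by field; rewrite gt_eqF.
Qed.

(** The square of a convex combination falls short of the combination of squares by [th * (1 - th)]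
    times the squared difference; the shift on the cycle preserves the energy. *)
Lemma energy_avg f (th : R) : f p = f 0%N ->
  energy (fun y => (1 - th) * f y + th * f y.+1) =
  energy f - th * (1 - th) * dirichlet f.
Proof.
move=> fp.
have -> : energy f = (1 - th) * energy f + th * \sum_(w < p) f w.+1 ^+ 2.
  by rewrite (sum_shift (g := fun w => f w ^+ 2)) ?fp // -/(energy f); ring.
rewrite /energy /dirichlet !mulr_sumr -sumrN -!big_split /=.
by apply: eq_bigr => y _; ring.
Qed.

End Nash.

Section Anticoncentration.
Variables (R : rcfType) (k : nat) (beta : nat -> 'I_k -> R).
Hypothesis beta_sum : forall i, \sum_j beta i j = 1.
Variable c : R.
Hypothesis c_gt0 : 0 < c.
Hypothesis beta_ge : forall i j, c <= beta i j.
Variables (j0 j1 : 'I_k).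
Hypothesis j01 : j1 != j0.

Let beta_ge0 i j : 0 <= beta i j.
Proof. by apply: le_trans (beta_ge i j); rewrite ltW. Qed.

Definition coord_step (y : nat) (j : 'I_k) : nat := (y + (j == j0))%N.

Lemma avg_coord_step i f y :
  avg_step beta coord_step i f y =
  (1 - beta i j0) * f y + beta i j0 * f y.+1.
Proof.
rewrite /avg_step (bigD1 j0) //= /coord_step eqxx addn1 addrC; congr (_ + _).
rewrite -(beta_sum i) [X in (X - _)](bigD1 j0) //= addrC addrK mulr_suml.
by apply: eq_bigr => j /negbTE ->; rewrite addn0.
Qed.

Lemma beta_compl i : c <= 1 - beta i j0.
Proof.
rewrite -(beta_sum i) (bigD1 j0) //= addrC addrK (bigD1 j1) //=.
by apply: ler_wpDr => //; apply: sumr_ge0.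
Qed.

Lemma c_le1 : c <= 1.
Proof. by have := beta_compl 0; have := beta_ge0 0 j0; lra. Qed.

Let hit p y : R := (p %| y)%:R.

Lemma expect_hit_period p a m y :
  expect beta coord_step a m (hit p) (p + y)%N =
  expect beta coord_step a m (hit p) y.
Proof.
rewrite -(expect_hom beta (h := addn p) (st := coord_step)) //.
  by apply: eq_expect => // y'; rewrite /hit dvdn_addr.
by move=> s j; rewrite /coord_step addnA.
Qed.

(** As a function of the start, the hitting probability is a probability vector on Z/p: initially a
    point mass at 0, then averaged with its shifts, which preserves the total. *)
Lemma expect_hit_sum p a m : (0 < p)%N ->
  \sum_(y < p) expect beta coord_step a m (hit p) y = 1.
Proof.
move=> p0; elim: m a => [|m IH] a.
  rewrite /= (bigD1 (Ordinal p0)) //= /hit dvdn0 big1 ?addr0 // => y y0.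
  by rewrite gtnNdvd // lt0n; apply: contraNneq y0 => y0; apply/eqP/val_inj.
pose f := expect beta coord_step a.+1 m (hit p).
rewrite (eq_bigr (fun y : 'I_p => (1 - beta a j0) * f y + beta a j0 * f y.+1)); last first.
  by move=> y _; exact: avg_coord_step.
have fp : f p = f 0%N by have := expect_hit_period p a.+1 m 0%N; rewrite addn0.
rewrite big_split -!mulr_sumr /= (sum_shift fp) IH; ring.
Qed.

(* The recursion [e' <= e - c ^+ 2 * e ^+ 3 / 32] drives [e ^+ 2] below [1 / (1 + c ^+ 2 / 32 * m)]. *)
Lemma energy_expect_hit p a m : (0 < p)%N ->
  let e := energy p (expect beta coord_step a m (hit p)) in
  e <= 2 / p%:R \/ e ^+ 2 * (1 + c ^+ 2 / 32 * m%:R) <= 1.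
Proof.
move=> p0 /=; elim: m a => [|m IH] a.
  right; rewrite mulr0 addr0 mulr1.
  rewrite [X in X ^+ _](_ : _ = 1) ?expr1n // -[RHS](expect_hit_sum a 0 p0).
  by apply: eq_bigr => y _ /=; rewrite /hit; case: (p %| y)%N; rewrite ?expr1n ?expr0n.
set f := expect beta coord_step a.+1 m (hit p).
have fp : f p = f 0%N by have := expect_hit_period p a.+1 m 0%N; rewrite addn0.
have f0 y : 0 <= f y by apply: expect_ge0 => // y'; rewrite /hit ler0n.
have -> : energy p (expect beta coord_step a m.+1 (hit p)) =
    energy p f - beta a j0 * (1 - beta a j0) * dirichlet p f.
  rewrite -energy_avg //; apply: eq_bigr => y _; congr (_ ^+ 2).
  exact: avg_coord_step.
have D0 : 0 <= dirichlet p f by apply: sumr_ge0 => y _; rewrite sqr_ge0.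
have cc : c ^+ 2 <= beta a j0 * (1 - beta a j0).
  by rewrite expr2 ler_pM // ?beta_compl // ltW.
have E0 : 0 <= energy p f - beta a j0 * (1 - beta a j0) * dirichlet p f.
  by rewrite -energy_avg // energy_ge0.
set e' := energy p f - _ in E0 *.
have e'e : e' <= energy p f - c ^+ 2 * dirichlet p f.
  by rewrite lerD2l lerN2 ler_wpM2r.
(* Energy never increases, so the first alternative persists once reached; before that, Nash's
   inequality applies. *)
have [small|big] := lerP (energy p f) (2 / p%:R).
  by left; apply: le_trans small; apply: le_trans e'e _; rewrite gerBl mulr_ge0 // sqr_ge0.
right; case: (IH a.+1); rewrite -/f => IHm; first by move: big; rewrite ltNge IHm.
have ns := nash_inequality p0 f0 fp (expect_hit_sum a.+1 m p0) (ltW big).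
set e := energy p f in ns IHm e'e *.
set g := c ^+ 2 / 32 in IHm *.
have g0 : 0 <= g by rewrite /g divr_ge0 // sqr_ge0.
have g1 : g <= 1.
  have : c ^+ 2 <= 1 by rewrite expr_le1 // ?c_le1 // ltW.
  by rewrite /g; lra.
have m0 : 0 <= m%:R :> R by rewrite ler0n.
have e0 : 0 <= e by apply: energy_ge0.
have e'g : e' <= e * (1 - g * e ^+ 2).
  apply: le_trans e'e _; have -> : e * (1 - g * e ^+ 2) = e - c ^+ 2 * (e ^+ 3 / 32).
    by rewrite /g; field.
  by rewrite lerD2l lerN2 ler_wpM2l // sqr_ge0.
set x := g * e ^+ 2.
have e2 : 0 <= e ^+ 2 by rewrite sqr_ge0.
have x0 : 0 <= x by rewrite mulr_ge0.
have x1 : x <= 1.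
  rewrite -[leRHS]mulr1 ler_pM //; apply: le_trans IHm.
  by rewrite ler_peMr // lerDl mulr_ge0.
have e'2 : e' ^+ 2 <= e ^+ 2 * (1 - x) ^+ 2.
  by rewrite -exprMn ler_pXn2r // nnegrE mulr_ge0 // subr_ge0.
apply: (@le_trans _ _ (e ^+ 2 * (1 - x) ^+ 2 * (1 + g * m.+1%:R))).
  by rewrite ler_wpM2r // addr_ge0 // mulr_ge0.
have -> : e ^+ 2 * (1 - x) ^+ 2 * (1 + g * m.+1%:R) =
  (1 - x) ^+ 2 * (e ^+ 2 * (1 + g * m%:R) + x) by rewrite /x -(natr1 m); ring.
apply: (@le_trans _ _ ((1 - x) ^+ 2 * (1 + x))).
  by rewrite ler_wpM2l ?sqr_ge0 // lerD2r.
have -> : (1 - x) ^+ 2 * (1 + x) = (1 - x) * (1 - x ^+ 2) by ring.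
by rewrite mulr_ile1 // ?subr_ge0 ?expr_le1 // gerBl // sqr_ge0.
Qed.

(** The square of one value is at most the energy. In the second alternative the fourth power is
    then at most [1 / (g * j^8)] with [g = c^2 / 32 <= 1]; asking for [j ^ 8] steps makes the fourth
    root a power of [j]. *)
Lemma expect_hit_le p a m j y : (0 < p)%N -> (0 < j)%N -> (j ^ 8 <= m)%N ->
  expect beta coord_step a m (hit p) y <=
  Num.sqrt (2 / p%:R) + 32 / c ^+ 2 / j%:R ^+ 2.
Proof.
move=> p0 jpos jm.
set P := expect _ _ _ _ _ _.
have P0 : 0 <= P by apply: expect_ge0 => // y'; rewrite /hit ler0n.
have Pe : P ^+ 2 <= energy p (expect beta coord_step a m (hit p)).
  have -> : P = expect beta coord_step a m (hit p) (y %% p)%N.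
    rewrite /P {1}(divn_eq y p); elim: (y %/ p)%N => // q IH.
    by rewrite mulSn -addnA expect_hit_period.
  rewrite /energy (bigD1 (Ordinal (ltn_pmod y p0))) //= lerDl.
  by apply: sumr_ge0 => i _; rewrite sqr_ge0.
have c20 : 0 < c ^+ 2 by rewrite exprn_gt0.
have jR : 0 < j%:R :> R by rewrite ltr0n.
have r0 : 0 <= 32 / c ^+ 2 / j%:R ^+ 2 by rewrite !divr_ge0 // ?exprn_ge0 // ltW.
have s0 : 0 <= Num.sqrt (2 / p%:R : R) by rewrite sqrtr_ge0.
have [e2p|ebound] := energy_expect_hit a m p0.
  apply: ler_wpDr => //.
  rewrite -(ger0_norm P0) -sqrtr_sqr ler_sqrt ?divr_ge0 //.
  exact: le_trans Pe e2p.
apply: ler_wpDl => //.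
rewrite ler_pdivlMr ?exprn_gt0 //.
set g := c ^+ 2 / 32 in ebound.
have g0 : 0 < g by rewrite divr_gt0.
have g1 : g <= 1.
  have : c ^+ 2 <= 1 by rewrite expr_le1 // ?c_le1 // ltW.
  by rewrite /g; lra.
have -> : 32 / c ^+ 2 = g^-1 by rewrite /g; field; rewrite gt_eqF.
rewrite -(@ler_pXn2r _ 4) // ?nnegrE ?mulr_ge0 ?exprn_ge0 ?invr_ge0 //; last exact: ltW.
apply: (@le_trans _ _ g^-1); last first.
  by rewrite -[leLHS]expr1 ler_weXn2l // invf_ge1.
rewrite -[g^-1]mul1r ler_pdivlMr //; apply: le_trans ebound.
have jm' : j%:R ^+ 8 <= m%:R :> R by rewrite -natrX ler_nat.
have P4 : P ^+ 4 <= energy p (expect beta coord_step a m (hit p)) ^+ 2.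
  by rewrite (exprM P 2 2) ler_pXn2r // nnegrE ?energy_ge0 ?sqr_ge0.
have -> : (P * j%:R ^+ 2) ^+ 4 * g = P ^+ 4 * (g * j%:R ^+ 8) by ring.
have g0' := ltW g0.
apply: ler_pM => //; [by rewrite exprn_ge0 | by apply: mulr_ge0; rewrite ?exprn_ge0 |].
by apply: (@le_trans _ _ (g * m%:R)); [apply: ler_wpM2l | rewrite lerDr].
Qed.

End Anticoncentration.

(** * Equidistribution modulo n *)

Lemma ler_sum_ord_widen (R : numDomainType) (p q : nat) (F : nat -> R) :
  (p <= q)%N -> (forall i, 0 <= F i) -> \sum_(i < p) F i <= \sum_(i < q) F i.
Proof.
move=> pq F0; rewrite -(subnKC pq) big_split_ord /= lerDl.
by apply: sumr_ge0.
Qed.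

(** Each exponent occurs at most [N] times, so the sum is at most [N] times a geometric series. *)
Lemma sum_geometric_floor_le (R : realFieldType) (N l : nat) (x : R) :
  (0 < N)%N -> 0 <= x < 1 ->
  \sum_(m < l) x ^+ (m %/ N)%N <= N%:R / (1 - x).
Proof.
move=> N0 /andP[x0 x1].
have full q : \sum_(m < q * N) x ^+ (m %/ N)%N = N%:R * \sum_(i < q) x ^+ i.
  elim: q => [|q IH]; first by rewrite mul0n !big_ord0 mulr0.
  rewrite mulSn addnC big_split_ord /= IH big_ord_recr /= mulrDr; congr (_ + _).
  under eq_bigr => i _ do rewrite divnMDl // divn_small // addn0.
  by rewrite sumr_const card_ord mulr_natl.
apply: (@le_trans _ _ (\sum_(m < l * N) x ^+ (m %/ N)%N)).
  apply: (@ler_sum_ord_widen _ _ _ (fun m => x ^+ (m %/ N)%N)) => [|i].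
    by rewrite leq_pmulr.
  by rewrite exprn_ge0.
have geo : (1 - x) * \sum_(i < l) x ^+ i = 1 - x ^+ l.
  by rewrite -opprB mulNr -subrX1 opprB.
rewrite full ler_wpM2l // -[leRHS]mul1r ler_pdivlMr ?subr_gt0 // mulrC geo.
by rewrite gerBl exprn_ge0.
Qed.

Section Equidistribution.
Variables (R : rcfType) (k : nat) (beta : nat -> 'I_k -> R).
Hypothesis beta_sum : forall i, \sum_j beta i j = 1.
Variable c : R.
Hypothesis c_gt0 : 0 < c.
Hypothesis c_lt1 : c < 1.
Hypothesis beta_ge : forall i j, c <= beta i j.
Variables (j0 : 'I_k) (n' : nat).
Local Notation n := n'.+1.
Local Notation V := {ffun 'I_k -> 'I_n}.

Let beta_ge0 i j : 0 <= beta i j.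
Proof. by apply: le_trans (beta_ge i j); rewrite ltW. Qed.

(** A generator of the additive group Z/n. The modulus may be 1, when no prime is sieved, and only
    the group structure is used. *)
Definition one_res : 'I_n := inZp 1.
Definition unit_res (j : 'I_k) : V := [ffun i => one_res *+ (i == j)].
Definition res_step (v : V) (j : 'I_k) : V := v + unit_res j.
Definition res_sum (v : V) : 'I_n := \sum_i v i.
(** Every step raises the coordinate sum by 1, so at each time the chain is confined to one of [n]
    cosets, and mixing is only possible inside it. *)
Definition level (i : nat) (v : V) : bool := res_sum v == one_res *+ i.

Lemma one_res_mul (x : 'I_n) : one_res *+ x = x.
Proof.
by apply/val_inj; rewrite Zp_mulrn /= modnMml mul1n modn_small.
Qed.

Lemma res_sumD u v : res_sum (u + v) = res_sum u + res_sum v.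
Proof. by rewrite /res_sum -big_split; apply: eq_bigr => i _; rewrite ffunE. Qed.

Lemma res_sum_unit j : res_sum (unit_res j) = one_res.
Proof.
rewrite /res_sum (bigD1 j) //= ffunE eqxx big1 ?addr0 // => i /negbTE ij.
by rewrite ffunE ij.
Qed.

Lemma level_step i v j : level i.+1 (res_step v j) = level i v.
Proof.
by rewrite /level /res_step res_sumD res_sum_unit mulrSr (inj_eq (addIr _)).
Qed.

Let level_next i v j : level i v -> level i.+1 (res_step v j).
Proof. by rewrite level_step. Qed.

Lemma foldl_res_step v w :
  foldl res_step v w = v + \sum_(j <- w) unit_res j.
Proof.
elim: w v => [|j w IH] v /=; first by rewrite big_nil addr0.
by rewrite IH big_cons addrA.
Qed.

Lemma level_foldl i v w :
  level (i + size w) (foldl res_step v w) = level i v.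
Proof.
elim: w i v => [|j w IH] i v /=; first by rewrite addn0.
by rewrite -addSnnS IH level_step.
Qed.

(* For [d = v' - v], whose coordinates sum to 0, playing each letter [j] exactly
   [d j] times from [v] leads where the same number of letters [j0] leads from
   [v']; more letters [j0] pad both words to length [k * n]. *)
Lemma res_meet a v v' : level a v -> level a v' ->
  exists w w', [/\ size w = (k * n)%N, size w' = (k * n)%N &
    foldl res_step v w = foldl res_step v' w'].
Proof.
move=> /eqP lv /eqP lv'; pose d := v' - v.
have d0 : res_sum d = 0.
  by apply: (@addrI _ (res_sum v)); rewrite -res_sumD /d addrC subrK addr0 lv.
pose w1 := flatten [seq nseq (d j) j | j <- enum 'I_k].
have sw1 : size w1 = (\sum_j d j)%N.
  rewrite size_flatten /shape -map_comp sumnE big_map big_enum /=.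
  by apply: eq_bigr => j _; rewrite size_nseq.
have w1le : (size w1 <= k * n)%N.
  rewrite sw1 -[k in (_ <= k * _)%N]card_ord -sum_nat_const.
  by apply: leq_sum => j _; apply/ltnW/ltn_ord.
have nse m j : \sum_(i <- nseq m j) unit_res i = unit_res j *+ m.
  elim: m => [|m IH] /=; first by rewrite big_nil mulr0n.
  by rewrite big_cons IH mulrS.
have vw1 : \sum_(j <- w1) unit_res j = d.
  rewrite big_flatten /= big_map big_enum /=.
  under eq_bigr do rewrite nse.
  apply/ffunP => i; rewrite sum_ffunE (bigD1 i) //= ffunMnE ffunE eqxx one_res_mul.
  rewrite big1 ?addr0 // => j /negbTE ji.
  by rewrite ffunMnE ffunE eq_sym ji mul0rn.
(* The length of [w1] is the sum of the coordinates of [d], hence a multiple of [n]: that many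
   letters [j0] cancel out. *)
have vsw1 : unit_res j0 *+ size w1 = 0.
  apply/ffunP => i; rewrite ffunMnE !ffunE.
  case: (i == j0); last by rewrite mul0rn.
  rewrite mulr1n sw1 -d0 /res_sum.
  transitivity (\sum_j one_res *+ d j).
    by elim/big_rec2: _ => [|j x y _ <-]; rewrite ?mulr0n // mulrnDr.
  by apply: eq_bigr => j _; rewrite one_res_mul.
exists (w1 ++ nseq (k * n - size w1) j0), (nseq (k * n) j0); split.
- by rewrite size_cat size_nseq subnKC.
- by rewrite size_nseq.
- rewrite !foldl_res_step big_cat !nse vw1 /=.
  rewrite -[in RHS](subnKC w1le) mulrnDr vsw1 add0r /d.
  by rewrite addrA [v + _]addrC subrK.
Qed.

Let delta : R := c ^+ (k * n).

(* Both starting points reach a common state with probability at least [delta]. *)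
Lemma expect_osc_step a (u : V -> R) K :
  (forall v v', level (a + k * n) v -> level (a + k * n) v' -> u v - u v' <= K) ->
  forall v v', level a v -> level a v' ->
  expect beta res_step a (k * n) u v - expect beta res_step a (k * n) u v' <=
  (1 - delta) * K.
Proof.
move=> uK v v' lv lv'.
have [w [w' [sw sw' ww']]] := res_meet lv lv'.
set y := foldl res_step v w in ww'.
have ly : level (a + k * n) y.
  by rewrite /y -sw level_foldl.
case: (@Order.TotalTheory.arg_maxP _ _ _ y (level (a + k * n)) u ly) => M lM uM.
case: (@Order.TotalTheory.arg_minP _ _ _ y (level (a + k * n)) u ly) => m lm um.
have MmK := uK _ _ lM lm.
have dpos : 0 <= delta by rewrite exprn_ge0 // ltW.
have delta1 : delta <= 1 by rewrite exprn_ile1 // ltW.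
have H1 : delta * (u M - u y) <= u M - expect beta res_step a (k * n) u v.
  have := @expect_word_ge _ _ _ beta_ge0 beta_sum _ res_step level c a w
    (fun x => u M + (-1) * u x) v (ltW c_gt0) beta_ge level_next lv.
  rewrite sw -/y -/delta expect_add // expect_cst // expect_scale // !mulN1r.
  by apply => x lx; rewrite mulN1r subr_ge0; apply: uM.
have H2 : delta * (u y - u m) <= expect beta res_step a (k * n) u v' - u m.
  have := @expect_word_ge _ _ _ beta_ge0 beta_sum _ res_step level c a w'
    (fun x => u x + (- u m)) v' (ltW c_gt0) beta_ge level_next lv'.
  rewrite sw' -ww' -/delta expect_add // expect_cst //.
  by apply => x lx; rewrite subr_ge0; apply: um.
apply: (@le_trans _ _ ((1 - delta) * (u M - u m))); last first.
  by rewrite ler_wpM2l // subr_ge0.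
(* Adding [H1] and [H2] eliminates [u y]. *)
lra.
Qed.

Lemma expect_osc a q r (f : V -> R) : (forall v, 0 <= f v <= 1) ->
  forall v v', level a v -> level a v' ->
  expect beta res_step a (q * (k * n) + r) f v -
  expect beta res_step a (q * (k * n) + r) f v' <= (1 - delta) ^+ q.
Proof.
move=> f01; elim: q a => [|q IH] a v v' lv lv'.
  rewrite mul0n add0n expr0.
  have h1 : expect beta res_step a r f v <= 1.
    by apply: expect_le1 => // x; case/andP: (f01 x).
  have h2 : 0 <= expect beta res_step a r f v'.
    by apply: expect_ge0 => // x; case/andP: (f01 x).
  lra.
rewrite mulSn -addnA !(expectD _ _ _ (k * n)) exprS.
by apply: expect_osc_step => // x x' lx lx'; apply: IH.
Qed.

(** Counting measure is transported from level to level, since each letter acts as a translation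
    mapping one level onto the next. *)
Lemma sum_level_expect a m (f : V -> R) :
  \sum_(v | level a v) expect beta res_step a m f v =
  \sum_(v | level (a + m) v) f v.
Proof.
elim: m a => [|m IH] a; first by rewrite addn0.
under eq_bigr do rewrite expectS.
rewrite exchange_big /= -addSnnS -IH.
rewrite -[RHS]mul1r -(beta_sum a) mulr_suml; apply: eq_bigr => j _.
rewrite -mulr_sumr; congr (_ * _).
rewrite [RHS](reindex_inj (addIr (unit_res j))) /=.
by apply: eq_bigl => v; rewrite level_step.
Qed.

Let card_level a : \sum_(v | level a v) 1 = \sum_(v | level 0 v) 1 :> R.
Proof.
rewrite -[a]add0n -(sum_level_expect 0 a (fun=> 1)).
by apply: eq_bigr => v _; rewrite expect_cst.
Qed.

Lemma sum_levels (f : V -> R) a :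
  \sum_(i < n) \sum_(v | level (a + i) v) f v = \sum_v f v.
Proof.
rewrite (exchange_big_dep xpredT) //=; apply: eq_bigr => v _.
have [x xE] : exists x : 'I_n, x = res_sum v - one_res *+ a by eexists.
rewrite (bigD1 x) /=; last first.
  by rewrite /level mulrnDr one_res_mul xE addrC subrK.
rewrite big1 ?addr0 // => i /andP[].
rewrite /level mulrnDr one_res_mul => /eqP E /eqP[].
by rewrite xE E addrC addKr.
Qed.

Let M : R := \sum_(v | level 0 v) 1.

Let M_card : n%:R * M = n%:R ^+ k.
Proof.
transitivity (\sum_(v : V) 1 : R); last first.
  by rewrite sumr_const card_ffun !card_ord natrX.
rewrite -(sum_levels (fun=> 1) 0).
under eq_bigr do rewrite card_level.
by rewrite sumr_const card_ord mulr_natl.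
Qed.

Let M_gt0 : 0 < M.
Proof.
have n0 : 0 < n%:R :> R by rewrite ltr0n.
by rewrite -(pmulr_rgt0 _ n0) M_card exprn_gt0.
Qed.

(** Averaged over all starts of the level, the expectation is exactly the mean of [f] over the final
    level; the start [v] is compared with each of them by the oscillation bound. *)
Lemma expect_level_mean a m (f : V -> R) v : (forall v, 0 <= f v <= 1) ->
  level a v ->
  `|expect beta res_step a m f v * M - \sum_(v | level (a + m) v) f v| <=
  M * (1 - delta) ^+ (m %/ (k * n))%N.
Proof.
move=> f01 lv; rewrite -sum_level_expect /M -(card_level a) mulr_sumr mulr_suml -sumrB.
apply: (le_trans (ler_norm_sum _ _ _)); apply: ler_sum => v' lv'.
rewrite mulr1 mul1r ler_norml lerNl opprB (divn_eq m (k * n)).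
have kn0 : (0 < k * n)%N by rewrite muln_gt0 (leq_ltn_trans _ (ltn_ord j0)).
rewrite divnMDl // (divn_small (ltn_pmod _ _)) // addn0.
by apply/andP; split; apply: expect_osc.
Qed.

Section Pairs.
Variable phi : V -> R.
Hypothesis phi01 : forall v, 0 <= phi v <= 1.
Hypothesis phi_sym : forall (s : {perm 'I_k}) (v : V), phi [ffun i => v (s i)] = phi v.

Let pair_sum i j := \sum_(v | level i v) phi v * phi (v + unit_res j).

(** Exchanging coordinates [j] and [j0] preserves both the level and [phi]. All letters thus
    contribute equally, and the step weights drop out of the limit. *)
Lemma pair_sum_sym i j : pair_sum i j = pair_sum i j0.
Proof.
pose s : {perm 'I_k} := tperm j j0.
pose h (v : V) : V := [ffun i => v (s i)].
have hh : involutive h by move=> v; apply/ffunP => x; rewrite !ffunE tpermK.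
rewrite /pair_sum (reindex_inj (inv_inj hh)) /=; apply: eq_big => v.
  rewrite /level /res_sum; congr (_ == _).
  by rewrite [RHS](reindex_inj (@perm_inj _ s)); apply: eq_bigr => x _; rewrite ffunE.
move=> _; rewrite phi_sym; congr (_ * _).
rewrite -(phi_sym s (v + _)); congr phi; apply/ffunP => x; rewrite !ffunE.
congr (_ + _ *+ _).
by rewrite -(inj_eq (@perm_inj _ s) x j) tpermL.
Qed.

Let g i v := phi v * avg_step beta res_step i phi v.

Let g01 i v : 0 <= g i v <= 1.
Proof.
have /andP[p0 p1] := phi01 v.
have s0 : 0 <= avg_step beta res_step i phi v.
  by apply: sumr_ge0 => j _; rewrite mulr_ge0 //; case/andP: (phi01 (res_step v j)).
have s1 : avg_step beta res_step i phi v <= 1.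
  rewrite -(beta_sum i); apply: ler_sum => j _.
  by rewrite -[leRHS]mulr1 ler_wpM2l //; case/andP: (phi01 (res_step v j)).
by rewrite /g mulr_ge0 //= mulr_ile1.
Qed.

Let sum_g i : \sum_(v | level i v) g i v = pair_sum i j0.
Proof.
rewrite -[RHS]mul1r -(beta_sum i) mulr_suml.
under eq_bigr do rewrite /g /avg_step mulr_sumr.
rewrite exchange_big; apply: eq_bigr => j _ /=.
rewrite -(pair_sum_sym i j) mulr_sumr.
by apply: eq_bigr => v _; rewrite mulrCA.
Qed.

Let tot := \sum_v phi v * phi (v + unit_res j0).

Let pair_sum_ge0 i : 0 <= pair_sum i j0.
Proof.
by apply: sumr_ge0 => v _; case/andP: (phi01 v) => ? ?;
  case/andP: (phi01 (v + unit_res j0)) => ? ?; rewrite mulr_ge0.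
Qed.

Let tot_le : tot <= n%:R * M.
Proof.
rewrite M_card -[k]card_ord -[n in leRHS]card_ord -natrX -card_ffun -sumr_const.
apply: ler_sum => v _; case/andP: (phi01 v) => ? ?.
by case/andP: (phi01 (v + unit_res j0)) => ? ?; rewrite mulr_ile1.
Qed.

(** Strong induction removing a full period of [n] levels, which contributes exactly [tot]; an
    incomplete period contributes between 0 and [tot], and so does its proportional share. *)
Lemma sum_pair_sum a l :
  `|\sum_(m < l) pair_sum (a + m) j0 - l%:R / n%:R * tot| <= tot.
Proof.
have tot0 : 0 <= tot.
  by rewrite /tot -(sum_levels _ 0); apply: sumr_ge0 => i _; apply: pair_sum_ge0.
elim/ltn_ind: l a => l IH a.
have nR : 0 < n%:R :> R by rewrite ltr0n.
have [ln|nl] := ltnP l n.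
  have r0 : 0 <= l%:R / n%:R * tot by rewrite !mulr_ge0 ?invr_ge0.
  have r1 : l%:R / n%:R * tot <= tot.
    by rewrite ler_piMl // ler_pdivrMr // mul1r ler_nat ltnW.
  have s0 : 0 <= \sum_(m < l) pair_sum (a + m) j0.
    by apply: sumr_ge0 => i _; apply: pair_sum_ge0.
  have s1 : \sum_(m < l) pair_sum (a + m) j0 <= tot.
    rewrite /tot -(sum_levels _ a).
    by apply: (@ler_sum_ord_widen _ _ _ (fun m => pair_sum (a + m) j0)) => //; apply: ltnW.
  rewrite ler_norml lerBrDr lerBlDr addrC.
  by rewrite (le_trans _ s0) ?subr_le0 //= (le_trans s1) // lerDl.
rewrite -(subnKC nl) big_split_ord /= natrD.
have -> : \sum_(i < n) pair_sum (a + i) j0 = tot by rewrite /tot -(sum_levels _ a).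
have E : n%:R / n%:R = 1 :> R by rewrite divff // gt_eqF.
rewrite [(n%:R + _) / _]mulrDl E mulrDl mul1r opprD addrACA subrr add0r.
under eq_bigr do rewrite addnA.
by apply: IH; rewrite ltn_subLR // -addn1 addnC leq_add2r.
Qed.

Lemma block_pair_mean : exists C : R, forall a l v, level a v ->
  `|\sum_(m < l) expect beta res_step a m
      (fun v => phi v * avg_step beta res_step (a + m) phi v) v -
    l%:R * (tot / n%:R ^+ k)| <= C.
Proof.
have kn0 : (0 < k * n)%N by rewrite muln_gt0 (leq_ltn_trans _ (ltn_ord j0)).
have d0 : 0 < delta by rewrite exprn_gt0.
have d1 : delta <= 1 by rewrite exprn_ile1 // ltW.
have nR : 0 < n%:R :> R by rewrite ltr0n.
(* The first term is the geometric sum of the mixing errors, the second accounts for the incomplete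
   period. *)
exists ((k * n)%:R / delta + n%:R) => a l v lv.
rewrite -(ler_pM2r M_gt0) -[X in _ * X <= _](gtr0_norm M_gt0) -normrM mulrBl.
have -> : l%:R * (tot / n%:R ^+ k) * M = l%:R / n%:R * tot.
  rewrite -M_card; move: (n%:R : R) nR (M) M_gt0 => x x0 y y0.
  by field; rewrite !gt_eqF.
rewrite mulr_suml.
have -> (x y : R) : x - y = (x - \sum_(m < l) pair_sum (a + m) j0) +
  (\sum_(m < l) pair_sum (a + m) j0 - y) by ring.
apply: (le_trans (ler_normD _ _)); rewrite mulrDl; apply: lerD; last first.
  exact: le_trans (sum_pair_sum _ _) tot_le.
rewrite -sumrB; apply: (le_trans (ler_norm_sum _ _ _)).
apply: (@le_trans _ _ (\sum_(m < l) M * (1 - delta) ^+ (m %/ (k * n))%N)).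
  apply: ler_sum => m _; rewrite -sum_g.
  by apply: expect_level_mean => // x; apply: g01.
rewrite -mulr_sumr mulrC ler_pM2r //.
rewrite [X in _ / X](_ : delta = 1 - (1 - delta)); last by ring.
apply: sum_geometric_floor_le => //.
by apply/andP; split; lra.
Qed.

End Pairs.
End Equidistribution.

(** * Estimates for sums over large primes *)

Lemma count_multiples_le (R : realFieldType) p a l : (0 < p <= l)%N ->
  (\sum_(m < l) (p %| a + m.+1)%N)%:R <= 2 * l%:R / p%:R :> R.
Proof.
case/andP=> p0 pl; have pR : 0 < p%:R :> R by rewrite ltr0n.
rewrite count_multiples // ler_pdivlMr // -!natrM ler_nat.
apply: (@leq_trans ((l %/ p + 1) * p)).
  by rewrite leq_mul2r leq_subLR addnA leq_divDl orbT.
by rewrite mulnDl mul1n mul2n -addnn leq_add // leq_divM.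
Qed.

(** Telescoping: the term at [p] is at most [2 / sqrt (p - 1) - 2 / sqrt p]. *)
Lemma sum_inv_three_halves (R : rcfType) M l : (2 <= M)%N ->
  \sum_(M <= p < l) (p%:R * Num.sqrt p%:R)^-1 <= 2 / Num.sqrt (M.-1)%:R :> R.
Proof.
move=> M2; have M1 : (0 < M.-1)%N by rewrite -ltnS prednK // ltnW.
have sgt i : (0 < i)%N -> 0 < Num.sqrt i%:R :> R by rewrite sqrtr_gt0 ltr0n.
have [lM|Ml] := leqP l M.
  by rewrite big_geq // divr_ge0 // sqrtr_ge0.
have {Ml} Ml := ltnW Ml.
suff : \sum_(M <= p < l) (p%:R * Num.sqrt p%:R)^-1 <=
    2 / Num.sqrt (M.-1)%:R - 2 / Num.sqrt (l.-1)%:R :> R.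
  by move=> H; apply: le_trans H _; rewrite gerBl divr_ge0 // sqrtr_ge0.
elim: l Ml => [|l IH]; first by rewrite leqn0 => /eqP E; rewrite E in M2.
rewrite leq_eqVlt => /orP[/eqP <-|]; first by rewrite big_geq // subrr.
rewrite ltnS => Ml; rewrite big_nat_recr //=.
apply: le_trans (lerD (IH Ml) (lexx _)) _.
have l1 : (0 < l.-1)%N by apply: leq_trans M1 _; rewrite -!subn1 leq_sub2r.
have l0 : (0 < l)%N by apply: leq_trans l1 (leq_pred _).
set v : R := Num.sqrt l%:R; set u : R := Num.sqrt (l.-1)%:R.
have v0 : 0 < v by apply: sgt.
have u0 : 0 < u by apply: sgt.
have vE : l%:R = v ^+ 2 by rewrite sqr_sqrtr.
have uE : u ^+ 2 = v ^+ 2 - 1.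
  by rewrite sqr_sqrtr // -vE -{2}(prednK l0) -natr1 addrK.
have uv : u <= v by rewrite ler_wsqrtr // ler_nat leq_pred.
rewrite vE -addrA lerD2l -subr_ge0.
have -> : - (2 / v) - (- (2 / u) + (v ^+ 2 * v)^-1) = (2 * v ^+ 2 * (v - u) - u) / (u * v ^+ 3).
  by field; rewrite !gt_eqF.
apply: divr_ge0; last by rewrite mulr_ge0 ?exprn_ge0 // ltW.
have s0 : 0 < v + u by rewrite addr_gt0.
have -> : v - u = (v + u)^-1.
  apply: (mulIf (lt0r_neq0 s0)); rewrite mulVf ?gt_eqF //.
  by rewrite -subr_sqr uE; ring.
rewrite subr_ge0 ler_pdivlMr //.
nra.
Qed.

(** * Mean score of a block *)

Definition pos_step (k : nat) (x : 'I_k -> nat) (j : 'I_k) : 'I_k -> nat :=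
  fun i => (x i + (i == j))%N.

Lemma sum_pos_step k (x : 'I_k -> nat) j :
  (\sum_i pos_step x j i)%N = (\sum_i x i).+1.
Proof.
rewrite /pos_step big_split /= (bigD1 (P := xpredT) (F := fun i => nat_of_bool (i == j)) j) //=.
by rewrite eqxx [X in (_ + (_ + X))%N]big1 ?addn0 ?addn1 // => i /negbTE ->.
Qed.

Section Block.
Variables (R : rcfType) (k : nat) (beta : nat -> 'I_k -> R).
Hypothesis beta_sum : forall i, \sum_j beta i j = 1.
Variable c : R.
Hypothesis c_gt0 : 0 < c.
Hypothesis c_lt1 : c < 1.
Hypothesis beta_ge : forall i j, c <= beta i j.
Variables (j0 j1 : 'I_k).
Hypothesis j01 : j1 != j0.

Let beta_ge0 i j : 0 <= beta i j.
Proof. by apply: le_trans (beta_ge i j); rewrite ltW. Qed.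

Local Notation pos := ('I_k -> nat).
Local Notation E := (expect beta (@pos_step k)).

(** The conditional expectation, given position [x] at time [i], of the product of the values of [f]
    at times [i] and [i + 1]. *)
Definition pair_visible (f : pos -> R) (i : nat) (x : pos) : R :=
  f x * avg_step beta (@pos_step k) i f x.

Definition primes_below (M : nat) := [seq p <- index_iota 0 M | prime p].

Definition sieve (M : nat) (x : pos) : R := (primitive_at (primes_below M) x)%:R.

Definition vis (x : pos) : R := (visible x)%:R.

Section Residues.
Variables (s : seq nat) (n' : nat).
Hypothesis s_prime : all prime s.
Hypothesis s_uniq : uniq s.
Hypothesis n_prod : n'.+1 = (\prod_(p <- s) p)%N.
Local Notation V := {ffun 'I_k -> 'I_n'.+1}.

Definition residues (x : pos) : V := [ffun i => inZp (x i)].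

Definition primitive_res (v : V) : R := (primitive_at s (fun i => v i))%:R.

Let s_dvd : all (dvdn^~ n'.+1) s.
Proof. by apply/allP => p ps; rewrite n_prod (big_rem p) //= dvdn_mulr. Qed.

Lemma residues_step x j : residues (pos_step x j) = res_step (residues x) j.
Proof.
apply/ffunP => i; rewrite !ffunE /pos_step; apply/val_inj => /=.
by rewrite Zp_mulrn /= modnMml mul1n modnDml modnDmr.
Qed.

Lemma primitive_residues x : primitive_res (residues x) = (primitive_at s x)%:R.
Proof.
rewrite /primitive_res; congr (_%:R); congr nat_of_bool.
apply: (primitive_at_mod s_dvd) => i.
by rewrite ffunE /= modn_mod.
Qed.

Lemma residues_level x : level (\sum_i x i)%N (residues x).
Proof.
rewrite /level /res_sum; apply/eqP.
transitivity (\sum_i one_res n' *+ x i); last first.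
  by elim/big_rec2: _ => [|j y z _ ->]; rewrite ?mulr0n // mulrnDr.
apply: eq_bigr => i _; rewrite ffunE; apply/val_inj.
by rewrite Zp_mulrn /= modnMml mul1n.
Qed.

Lemma primitive_res_pair v :
  primitive_res v * primitive_res (v + unit_res n' j0) =
  (primitive_pair j0 s (fun i => v i))%:R.
Proof.
rewrite -natrM mulnb; congr (_%:R); congr nat_of_bool; congr (_ && _).
apply: (primitive_at_mod s_dvd) => i.
by rewrite !ffunE /= Zp_mulrn /= modnMml mul1n modnDmr modn_mod.
Qed.

Lemma primitive_res_sym (t : {perm 'I_k}) (v : V) :
  primitive_res [ffun i => v (t i)] = primitive_res v.
Proof.
congr (_%:R); congr nat_of_bool; apply: eq_all => p; congr (~~ _).
apply/forallP/forallP => H i; last by rewrite ffunE.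
by have := H ((t^-1)%g i); rewrite ffunE permKV.
Qed.

(** The count of good residues is a product of [p ^ k - 2], while [n ^ k] is the product of the
    [p ^ k]. *)
Lemma prod_density :
  (\sum_(v : V) primitive_res v * primitive_res (v + unit_res n' j0)) /
     n'.+1%:R ^+ k = \prod_(p <- s) (1 - 2 / p%:R ^+ k) :> R.
Proof.
rewrite (eq_bigr (fun v : V => (primitive_pair j0 s (fun i => v i))%:R)); last first.
  by move=> v _; rewrite -primitive_res_pair.
rewrite -natr_sum count_primitive_pair // n_prod.
move: s_prime; clear -j0; elim: s => [|p r IH] /=.
  by rewrite !big_nil expr1n divr1.
case/andP=> pp pr; rewrite !big_cons -IH // !natrM exprMn invfM mulrACA.
congr (_ * _); have p2 := prime_gt1 pp.
rewrite natrB; last first.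
  apply: (@leq_trans p) => //; rewrite -[leqLHS]expn1 leq_pexp2l //; last first.
    by rewrite (leq_ltn_trans _ (ltn_ord j0)).
  exact: prime_gt0.
by rewrite natrX mulrBl divff // expf_neq0 // pnatr_eq0 -lt0n prime_gt0.
Qed.

Lemma sieve_pair_mean : exists C : R, forall a l x, (\sum_i x i = a)%N ->
  `|\sum_(m < l) E a m (pair_visible (fun x => (primitive_at s x)%:R) (a + m)) x -
    l%:R * \prod_(p <- s) (1 - 2 / p%:R ^+ k)| <= C.
Proof.
have p01 v : 0 <= primitive_res v <= 1.
  by rewrite /primitive_res; case: (primitive_at _ _); rewrite !(lexx, ler01).
have [C HC] := block_pair_mean beta_sum c_gt0 c_lt1 beta_ge j0 p01 primitive_res_sym.
exists C => a l x xa; rewrite -prod_density.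
have := HC a l (residues x); rewrite -{1}xa residues_level => /(_ isT).
congr (`| _ - _ | <= _); apply: eq_bigr => m _.
rewrite -(expect_hom beta a m _ x residues_step); apply: eq_expect => // y.
rewrite /pair_visible primitive_residues; congr (_ * _).
by apply: eq_bigr => j _; rewrite -residues_step primitive_residues.
Qed.

End Residues.

Lemma sieve_block_mean M : exists C : R, forall a l x, (\sum_i x i = a)%N ->
  `|\sum_(m < l) E a m (pair_visible (sieve M) (a + m)) x -
    l%:R * \prod_(0 <= p < M | prime p) (1 - 2 / p%:R ^+ k)| <= C.
Proof.
have ps : all prime (primes_below M) by apply: filter_all.
have us : uniq (primes_below M) by rewrite filter_uniq // iota_uniq.
have n0 : (0 < \prod_(p <- primes_below M) p)%N.
  rewrite big_seq; apply: prodn_cond_gt0 => q qs.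
  exact: prime_gt0 (allP ps q qs).
have [C HC] := sieve_pair_mean ps us (prednK n0).
by exists C => a l x xa; rewrite -big_filter; apply: HC.
Qed.

Lemma vis_le_sieve M x : vis x <= sieve M x.
Proof.
rewrite /vis /sieve ler_nat; case vx : (visible x) => //.
suff -> : primitive_at (primes_below M) x by [].
apply/allP => p; rewrite mem_filter => /andP[pp _]; apply/forallP => H.
have : (p %| \big[gcdn/0]_(j < k) x j)%N by apply/dvdn_biggcdP => i _; apply: H.
by rewrite (eqP vx) dvdn1 => /eqP p1; rewrite p1 in pp.
Qed.

Let hit p y : R := (p %| y)%N%:R.

(** If [x] passes the sieve without being visible, the least prime factor of the gcd of its
    coordinates is at least [M] and divides both [i] and [x j0]. Those below [l] will be averaged
    over the times [i]; those from [l] on are few, being prime divisors of [i]. *)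
Lemma sieve_vis_le M l x i : (\sum_j x j = i)%N -> (0 < i)%N ->
  sieve M x - vis x <=
  \sum_(M <= p < l | prime p && (p %| i)%N) hit p (x j0) +
  \sum_(p <- primes i | (l <= p)%N) hit p (x j0).
Proof.
move=> xi i0.
have S1 : 0 <= \sum_(M <= p < l | prime p && (p %| i)%N) hit p (x j0).
  by apply: sumr_ge0.
have S2 : 0 <= \sum_(p <- primes i | (l <= p)%N) hit p (x j0).
  by apply: sumr_ge0.
rewrite /sieve /vis; case sx : (primitive_at _ _); last first.
  by rewrite sub0r (le_trans (y := 0)) ?oppr_le0 ?addr_ge0.
case vx : (visible x); first by rewrite subrr addr_ge0.
rewrite subr0; set g := (\big[gcdn/0%N]_(j < k) x j).
have gi : (g %| i)%N.
  by rewrite -xi; apply: dvdn_sum => j _; apply: (biggcdn_inf j).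
have g1 : (1 < g)%N.
  have : (0 < g)%N by rewrite lt0n; apply: contraTneq gi => ->; rewrite dvd0n -lt0n.
  by rewrite leq_eqVlt eq_sym -/(visible x) vx.
have pp := pdiv_prime g1; set p := pdiv g in pp.
have px j : (p %| x j)%N.
  by apply: dvdn_trans (pdiv_dvd g) _; apply: (biggcdn_inf j).
have pi : (p %| i)%N := dvdn_trans (pdiv_dvd g) gi.
have Mp : (M <= p)%N.
  rewrite leqNgt; apply/negP => pM.
  have : p \in primes_below M by rewrite mem_filter pp mem_index_iota.
  by move=> /(allP sx)/forallP[].
have [lp|pl] := leqP l p.
  apply: ler_wpDl => //.
  have pin : p \in primes i by rewrite mem_primes pp i0.
  rewrite (big_rem p) //= lp /hit px lerDl.
  by apply: sumr_ge0.
apply: ler_wpDr => //.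
have pin : p \in index_iota M l by rewrite mem_index_iota Mp.
by rewrite (big_rem p) //= pp pi /hit px lerDl sumr_ge0.
Qed.

Lemma sqrt_two_div_le p : Num.sqrt (2 / p%:R) <= 2 / Num.sqrt p%:R :> R.
Proof.
have -> : 2 / Num.sqrt p%:R = Num.sqrt (4 / p%:R) :> R.
  rewrite sqrtrM // sqrtrV //; congr (_ / _).
  by rewrite (_ : 4 = 2 ^+ 2 :> R) ?sqrtr_sqr ?ger0_norm // -natrX.
by rewrite ler_wsqrtr // ler_wpM2r ?invr_ge0 ?ler_nat.
Qed.

Let err (j : nat) : R := 32 / c ^+ 2 / j%:R ^+ 2.

Let err_ge0 j : 0 <= err j.
Proof. by rewrite /err !divr_ge0 // exprn_ge0 // ltW. Qed.

Lemma expect_hit_coord_le p a m j x : (0 < p)%N -> (0 < j)%N -> (j ^ 8 <= m)%N ->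
  E a m (fun y => hit p (y j0)) x <= 2 / Num.sqrt p%:R + err j.
Proof.
move=> p0 jpos jm.
rewrite (@expect_hom _ _ beta _ _ _ (coord_step j0) (fun y : pos => y j0) a m (hit p)); last first.
  by move=> y i; rewrite /pos_step /coord_step eq_sym.
apply: le_trans (expect_hit_le beta_sum c_gt0 beta_ge j01 a (x j0) p0 jpos jm) _.
by rewrite lerD2r sqrt_two_div_le.
Qed.

Lemma count_prime_divisors_le M l i : (0 < i)%N ->
  (\sum_(M <= p < l | prime p && (p %| i)) 1 <= size (primes i))%N.
Proof.
move=> i0; rewrite sum1_count -size_filter; apply: uniq_leq_size.
  by rewrite filter_uniq // iota_uniq.
by move=> p; rewrite mem_filter mem_primes i0 => /andP[-> _].
Qed.

(** Primality of [p] is dropped: the series of [p^(-3/2)] over all integers converges, and this is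
    all that averaging over [i] requires. *)
Let tail_term (M l i : nat) : R :=
  \sum_(M <= p < l | (p %| i)%N && (0 < p)%N) 2 / Num.sqrt p%:R.

(** A time at most [j ^ 20] has at most [20 * j] prime divisors, and those from [j ^ 10] on satisfy
    [sqrt p >= j ^ 5]. Only the [2 / sqrt p] of the smaller primes is kept for later averaging. *)
Lemma expect_sieve_vis_le M j a m x : (\sum_i x i = a)%N -> (0 < j)%N ->
  (j ^ 8 <= m)%N -> (a + m <= j ^ 20)%N ->
  E a m (fun y => sieve M y - vis y) x <=
  tail_term M (j ^ 10) (a + m) + (20 * j)%:R * (2 / j%:R ^+ 5 + 2 * err j).
Proof.
move=> xa jpos jm amj; set l := (j ^ 10)%N; set i := (a + m)%N.
have jR : 0 < j%:R :> R by rewrite ltr0n.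
have i0 : (0 < i)%N.
  by rewrite (leq_trans _ (leq_addl a m)) // (leq_trans _ jm) // expn_gt0 jpos.
have wi : (size (primes i) <= 20 * j)%N by apply: size_primes_le.
apply: (@le_trans _ _ (E a m (fun y =>
  \sum_(M <= p < l | prime p && (p %| i)%N) hit p (y j0) +
  \sum_(p <- primes i | (l <= p)%N) hit p (y j0)) x)).
  apply: (@expect_inv_le _ _ _ beta_ge0 _ _ (fun i y => (\sum_j y j)%N = i)) => //.
    by move=> i' y j'; rewrite sum_pos_step => ->.
  by move=> y yi; apply: sieve_vis_le.
rewrite expect_add !(expect_sum beta_ge0 beta_sum).
have e0 := err_ge0 j.
have wiR n : (n <= size (primes i))%N -> n%:R <= (20 * j)%:R :> R.
  by move=> nw; rewrite ler_nat (leq_trans nw).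
have S1 : \sum_(M <= p < l | prime p && (p %| i)%N) E a m (fun y => hit p (y j0)) x
    <= tail_term M l i + (20 * j)%:R * err j.
  apply: (@le_trans _ _ (\sum_(M <= p < l | prime p && (p %| i)%N)
      (2 / Num.sqrt p%:R + err j))).
    apply: ler_sum => p /andP[pp _]; apply: expect_hit_coord_le => //.
    exact: prime_gt0.
  rewrite big_split /=; apply: lerD.
    rewrite /tail_term big_mkcond [leRHS]big_mkcond; apply: ler_sum => p _.
    case pp: (prime p) => /=; first by rewrite (prime_gt0 pp) andbT.
    by case: ifP => // _; rewrite divr_ge0 // sqrtr_ge0.
  apply: (@le_trans _ _ ((\sum_(M <= p < l | prime p && (p %| i)) 1)%N%:R * err j)).
    rewrite natr_sum mulr_suml; apply: ler_sum => p _.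
    by rewrite mul1r.
  by rewrite ler_wpM2r // wiR // count_prime_divisors_le.
have S2 : \sum_(p <- primes i | (l <= p)%N) E a m (fun y => hit p (y j0)) x
    <= (20 * j)%:R * (2 / j%:R ^+ 5 + err j).
  have b0 : 0 <= 2 / j%:R ^+ 5 + err j by rewrite addr_ge0 // divr_ge0 // exprn_ge0 // ltW.
  apply: (@le_trans _ _ (\sum_(p <- primes i) (2 / j%:R ^+ 5 + err j))).
    rewrite big_mkcond; rewrite big_seq [leRHS]big_seq; apply: ler_sum => p pi.
    case: ifP => // lp.
    have pp : prime p by move: pi; rewrite mem_primes => /andP[].
    apply: le_trans (expect_hit_coord_le a x (prime_gt0 pp) jpos jm) _.
    have j5 : 0 < j%:R ^+ 5 :> R by rewrite exprn_gt0.
    have js : j%:R ^+ 5 <= Num.sqrt p%:R :> R.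
      rewrite -[leLHS](ger0_norm (ltW j5)) -sqrtr_sqr ler_wsqrtr //.
      by rewrite -exprM -natrX ler_nat.
    by rewrite lerD2r ler_wpM2l // lef_pV2 // posrE // (lt_le_trans j5).
  rewrite big_const_seq count_predT iter_addr addr0 -[leLHS]mulr_natl.
  by rewrite ler_wpM2r // wiR.
apply: le_trans (lerD S1 S2) _.
have -> : 2 / j%:R ^+ 5 + 2 * err j = err j + (2 / j%:R ^+ 5 + err j) by ring.
by rewrite [in leRHS]mulrDr addrA.
Qed.

(** Here 41 is 1 for the first [j ^ 8] times plus [20 * 2] for the primes from [j ^ 10] on, and 1280
    is [20 * 2 * 32], from the two occurrences of [err]. *)
Let D : R := 41 + 1280 / c ^+ 2.

(** After exchanging the sums, each [p < l] has at most [2 * l / p] multiples among [l] consecutive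
    times, which turns [2 / sqrt p] into [4 * l * p^(-3/2)]. *)
Lemma sum_tail_term M l a : (2 <= M)%N ->
  \sum_(m < l) tail_term M l (a + m.+1) <= l%:R * (8 / Num.sqrt (M.-1)%:R).
Proof.
move=> M2; rewrite /tail_term.
apply: (@le_trans _ _ (\sum_(M <= p < l) (4 * l%:R) * (p%:R * Num.sqrt p%:R)^-1)); last first.
  rewrite -mulr_sumr.
  have -> : l%:R * (8 / Num.sqrt (M.-1)%:R) = (4 * l%:R) * (2 / Num.sqrt (M.-1)%:R) :> R by ring.
  by rewrite ler_wpM2l ?mulr_ge0 // sum_inv_three_halves.
rewrite (exchange_big_dep xpredT) //= big_nat_cond [leRHS]big_nat_cond.
apply: ler_sum => p /andP[/andP[Mp pl] _].
have p0 : (0 < p)%N by apply: leq_trans Mp; apply: leq_trans M2.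
have s0 : 0 < Num.sqrt p%:R :> R by rewrite sqrtr_gt0 ltr0n.
have pR : 0 < p%:R :> R by rewrite ltr0n.
apply: (@le_trans _ _ (2 / Num.sqrt p%:R * (\sum_(m < l) (p %| a + m.+1)%N)%:R)).
  rewrite natr_sum mulr_sumr big_mkcond /=; apply: ler_sum => m _.
  by rewrite p0 andbT; case: (p %| _)%N; rewrite ?mulr1 ?mulr0.
apply: (@le_trans _ _ (2 / Num.sqrt p%:R * (2 * l%:R / p%:R))).
  by rewrite ler_wpM2l ?divr_ge0 ?sqrtr_ge0 // count_multiples_le // p0 ltnW.
by rewrite le_eqVlt; apply/orP; left; apply/eqP; field; rewrite !gt_eqF.
Qed.

Lemma sum_expect_sieve_vis M j a x : (2 <= M)%N -> (\sum_i x i = a)%N ->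
  (0 < j)%N -> (a + j ^ 10 <= j ^ 20)%N ->
  \sum_(m < j ^ 10) E a m.+1 (fun y => sieve M y - vis y) x <=
  (j ^ 10)%:R * (D / j%:R + 8 / Num.sqrt (M.-1)%:R).
Proof.
move=> M2 xa jpos aj; set l := (j ^ 10)%N.
have jR : 0 < j%:R :> R by rewrite ltr0n.
have j1R : 1 <= j%:R :> R by rewrite ler1n.
have e0 := err_ge0 j.
set K := (20 * j)%:R * (2 / j%:R ^+ 5 + 2 * err j).
have K0 : 0 <= K.
  have d0 : 0 <= 2 / j%:R ^+ 5 :> R by rewrite divr_ge0 // exprn_ge0 // ltW.
  by rewrite mulr_ge0 // addr_ge0 // mulr_ge0.
have t0 M' l' i : 0 <= tail_term M' l' i.
  by apply: sumr_ge0 => p _; rewrite divr_ge0 // sqrtr_ge0.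
(* Anticoncentration needs [j ^ 8] steps; earlier times are bounded by 1 each, a negligible share of
   [j ^ 10]. *)
apply: (@le_trans _ _ (\sum_(m < l) (((m < j ^ 8)%N)%:R + tail_term M l (a + m.+1) + K))).
  apply: ler_sum => m _; have [mj|jm] := ltnP m (j ^ 8).
    rewrite -addrA; apply: ler_wpDr; first by rewrite addr_ge0.
    apply: expect_le1 => // y; rewrite lerBlDr ler_wpDr // /vis ?ler0n //.
    by rewrite /sieve; case: (primitive_at _ _).
  rewrite add0r; apply: expect_sieve_vis_le => //; first exact: leqW.
  by apply: leq_trans aj; rewrite leq_add2l.
rewrite !big_split /= mulrDr addrAC; apply: lerD; last exact: sum_tail_term.
rewrite sumr_const card_ord -[K *+ l]mulr_natl.
have S1 : \sum_(m < l) ((m < j ^ 8)%N)%:R <= j%:R ^+ 8 :> R.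
  have jl : (j ^ 8 <= l)%N by rewrite leq_pexp2l.
  rewrite -(subnKC jl) big_split_ord /= [X in _ + X]big1 ?addr0 => [|i _]; last first.
    by rewrite ltnNge leq_addr.
  under eq_bigr => i _ do rewrite ltn_ord.
  by rewrite sumr_const card_ord -natrX.
apply: le_trans (lerD S1 (lexx _)) _.
rewrite /K /D /err /l natrM natrX.
move: (j%:R : R) jR j1R => t t0' t1.
have c0 := c_gt0.
have -> : t ^+ 10 * (20 * t * (2 / t ^+ 5 + 2 * (32 / c ^+ 2 / t ^+ 2))) =
   40 * t ^+ 6 + 1280 / c ^+ 2 * t ^+ 9.
  by field; rewrite !gt_eqF.
have -> : t ^+ 10 * ((41 + 1280 / c ^+ 2) / t) = t ^+ 9 + 40 * t ^+ 9 + 1280 / c ^+ 2 * t ^+ 9.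
  by field; rewrite !gt_eqF.
rewrite addrA lerD2r lerD //; first by rewrite ler_weXn2l.
by rewrite ler_wpM2l // ler_weXn2l.
Qed.

(** For factors in [0, 1], replacing both changes the product by at most the sum of the two
    changes. *)
Lemma pair_visible_bounds M i x :
  pair_visible vis i x <= pair_visible (sieve M) i x <=
  pair_visible vis i x + ((sieve M x - vis x) +
    avg_step beta (@pos_step k) i (fun y => sieve M y - vis y) x).
Proof.
have v0 y : 0 <= vis y by rewrite /vis ler0n.
have s1 y : sieve M y <= 1 by rewrite /sieve; case: (primitive_at _ _).
have vs y := vis_le_sieve M y.
have s0 y : 0 <= sieve M y by rewrite (le_trans (v0 y)).
have av : 0 <= avg_step beta (@pos_step k) i vis x.
  by apply: sumr_ge0 => j _; rewrite mulr_ge0.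
have avs : avg_step beta (@pos_step k) i vis x <= avg_step beta (@pos_step k) i (sieve M) x.
  by apply: ler_sum => j _; rewrite ler_wpM2l.
have as1 : avg_step beta (@pos_step k) i (sieve M) x <= 1.
  rewrite -(beta_sum i); apply: ler_sum => j _.
  by rewrite -[leRHS]mulr1 ler_wpM2l.
have -> : avg_step beta (@pos_step k) i (fun y => sieve M y - vis y) x =
  avg_step beta (@pos_step k) i (sieve M) x - avg_step beta (@pos_step k) i vis x.
  by rewrite /avg_step -sumrB; apply: eq_bigr => j _; rewrite mulrBr.
rewrite /pair_visible; move: av avs as1 (v0 x) (vs x) (s1 x).
move: (avg_step _ _ _ vis x) (avg_step _ _ _ (sieve M) x) (vis x) (sieve M x).
by move=> B A b a *; apply/andP; split; nra.
Qed.

Lemma vis_block_mean M : (2 <= M)%N -> exists C : R, forall j a x,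
  (\sum_i x i = a)%N -> (0 < j)%N -> (a + j ^ 10 <= j ^ 20)%N ->
  `|\sum_(m < j ^ 10) E a m (pair_visible vis (a + m)) x -
    (j ^ 10)%:R * \prod_(0 <= p < M | prime p) (1 - 2 / p%:R ^+ k)| <=
  C + 2 * (j ^ 10)%:R * (D / j%:R + 8 / Num.sqrt (M.-1)%:R).
Proof.
move=> M2; have [C HC] := sieve_block_mean M.
exists (C + 1) => j a x xa jpos aj.
set l := (j ^ 10)%N; pose B y := sieve M y - vis y.
have T := sum_expect_sieve_vis M2 xa jpos aj; rewrite -/l -/B in T.
set S := \sum_(m < l) E a m.+1 B x in T.
have := HC a l x xa.
set s1 := \sum_(m < l) E a m (pair_visible (sieve M) (a + m)) x.
set s2 := \sum_(m < l) E a m (pair_visible vis (a + m)) x.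
have s21 : s2 <= s1.
  apply: ler_sum => m _; apply: expect_le => // y.
  by case/andP: (pair_visible_bounds M (a + m) y).
have B0 y : 0 <= B y by rewrite subr_ge0 vis_le_sieve.
(* The losses at the first points of the pairs form the same sum as [S] shifted by one time, hence
   at most [1 + S]. *)
have s12 : s1 <= s2 + (1 + 2 * S).
  apply: (@le_trans _ _ (s2 + (\sum_(m < l) E a m B x + S))).
    have -> : S = \sum_(m < l) E a m (avg_step beta (@pos_step k) (a + m) B) x.
      by apply: eq_bigr => m _; rewrite expectS_last.
    rewrite /s1 /s2 -!big_split /=; apply: ler_sum => m _.
    rewrite -!expect_add; apply: expect_le => // y.
    by case/andP: (pair_visible_bounds M (a + m) y).
  rewrite lerD2l.
  have : \sum_(m < l) E a m B x <= 1 + S.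
    apply: (@le_trans _ _ (\sum_(m < l.+1) E a m B x)).
      by rewrite big_ord_recr /= lerDl expect_ge0.
    rewrite big_ord_recl lerD2r /= /B lerBlDr ler_wpDr // /vis ?ler0n //.
    by rewrite /sieve; case: (primitive_at _ _).
  lra.
move: T; set Q := _ * (_ + _) => T.
rewrite -mulrA -/Q !ler_norml => /andP[h1 h2].
by apply/andP; split; lra.
Qed.

End Block.

(** * Deviations of the score *)

Section Excess.
Variable R : realFieldType.

(** The distance from [z] to the interval [-t, t]. *)
Definition excess (t z : R) : R := Num.max 0 (`|z| - t).

Lemma excess_ge0 t z : 0 <= excess t z.
Proof. by rewrite le_max lexx. Qed.

(** The witness is [z] minus its projection onto [-t, t]: a signed excess, around which a square can
    be expanded. *)
Lemma excess_witness t z : 0 <= t ->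
  exists2 w, w ^+ 2 = excess t z ^+ 2 & `|z - w| <= t.
Proof.
move=> t0; have [zt|tz] := lerP `|z| t.
  exists 0; last by rewrite subr0.
  by rewrite /excess (max_idPl _) ?expr0n // subr_le0.
have ex : excess t z = `|z| - t by rewrite /excess (max_idPr _) // subr_ge0 ltW.
rewrite ex; have [z0|z0] := lerP 0 z.
  exists (z - t); first by rewrite ger0_norm.
  by rewrite (_ : z - (z - t) = t) ?ger0_norm //; ring.
exists (z + t); first by rewrite ltr0_norm // -sqrrN; congr (_ ^+ 2); ring.
by rewrite (_ : z - (z + t) = - t) ?normrN ?ger0_norm //; ring.
Qed.

Lemma excess_add_le t s z w u D : `|z - w| <= t -> `|u| <= s ->
  excess (t + s) (z + u + D) ^+ 2 <= (w + D) ^+ 2.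
Proof.
move=> zw us; rewrite -[leRHS]real_normK ?num_real // ler_pXn2r ?nnegrE ?excess_ge0 //.
rewrite ge_max normr_ge0 /= lerBlDr.
have -> : z + u + D = (w + D) + ((z - w) + u) by ring.
apply: (le_trans (ler_normD _ _)); rewrite lerD2l.
by apply: (le_trans (ler_normD _ _)); rewrite lerD.
Qed.

End Excess.

Section Score.
Variables (R : rcfType) (k : nat) (beta : nat -> 'I_k -> R).
Hypothesis beta_ge0 : forall i j, 0 <= beta i j.
Hypothesis beta_sum : forall i, \sum_j beta i j = 1.

Local Notation pos := ('I_k -> nat).

Definition score_step (s : pos * R) (j : 'I_k) : pos * R :=
  (pos_step s.1 j, s.2 + vis R s.1 * vis R (pos_step s.1 j)).

Definition mean_score (a l : nat) (x : pos) : R :=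
  \sum_(m < l) expect beta (@pos_step k) a m (pair_visible beta (@vis R k) (a + m)) x.

Lemma vis_ge0 (x : pos) : 0 <= vis R x.
Proof. by rewrite /vis ler0n. Qed.

Lemma vis_le1 (x : pos) : vis R x <= 1.
Proof. by rewrite /vis; case: visible. Qed.

Lemma expect_score a l (s : pos * R) :
  expect beta score_step a l (fun s' => s'.2) s = s.2 + mean_score a l s.1.
Proof.
elim: l a s => [|l IH] a s; first by rewrite /mean_score big_ord0 addr0.
rewrite expectS; under eq_bigr do rewrite IH /= mulrDr mulrDr.
rewrite !big_split /= -mulr_suml beta_sum mul1r -addrA; congr (_ + _).
rewrite /mean_score big_ord_recl /= addn0; congr (_ + _).
  rewrite /pair_visible /avg_step mulr_sumr.
  by apply: eq_bigr => j _; rewrite mulrCA.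
under eq_bigr do rewrite mulr_sumr.
rewrite exchange_big; apply: eq_bigr => m _ /=.
by rewrite /bump /= add1n -addSnnS.
Qed.

(* The excess over the tolerance [eps * b] is a Lyapunov function: the drift of a
   block, at most [eps * l], is absorbed by the growth of the tolerance, and only
   the variance of the block remains. *)
Lemma expect_excess_step a l b c eps s :
  0 <= eps -> `|mean_score a l s.1 - l%:R * c| <= eps * l%:R ->
  expect beta score_step a l
    (fun s' => excess (eps * (b + l)%:R) (s'.2 - (b + l)%:R * c) ^+ 2) s <=
  excess (eps * b%:R) (s.2 - b%:R * c) ^+ 2 + l%:R ^+ 2.
Proof.
move=> eps0 Gl; set z := s.2 - b%:R * c.
have [|w w2 zw] := @excess_witness R (eps * b%:R) z; first by rewrite mulr_ge0.
pose mu := mean_score a l s.1.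
have mu0 : 0 <= mu.
  apply: sumr_ge0 => m _; apply: expect_ge0 => // x.
  rewrite /pair_visible mulr_ge0 ?vis_ge0 // sumr_ge0 // => j _.
  by rewrite mulr_ge0 // vis_ge0.
have mul : mu <= l%:R.
  rewrite -[l in leRHS]card_ord -sumr_const; apply: ler_sum => m _.
  apply: expect_le1 => // x; rewrite /pair_visible mulr_ile1 ?vis_ge0 ?vis_le1 //.
    by rewrite sumr_ge0 // => j _; rewrite mulr_ge0 // vis_ge0.
  rewrite -(beta_sum (a + m)); apply: ler_sum => j _.
  by rewrite -[leRHS]mulr1 ler_wpM2l // vis_le1.
(* Each step scores between 0 and 1, so the centred increment of the block has absolute value at
   most [l]. *)
pose I i (s' : pos * R) := s.2 <= s'.2 <= s.2 + (i%:R - a%:R).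
(* This integrand is [w^2 + 2 * w * D + l^2] with [D] the centred increment, written as an affine
   function of the score; the term in [D] has mean 0. *)
apply: (@le_trans _ _ (expect beta score_step a l
  (fun s' => (w ^+ 2 - 2 * w * (s.2 + mu) + l%:R ^+ 2) + 2 * w * s'.2) s)).
  apply: (@expect_inv_le _ _ _ beta_ge0 _ _ I).
  - move=> i s' j /andP[h1 h2]; rewrite /I /= -natr1.
    have v0 := vis_ge0 s'.1; have v1 := vis_le1 s'.1.
    have u0 := vis_ge0 (pos_step s'.1 j); have u1 := vis_le1 (pos_step s'.1 j).
    have p0 := mulr_ge0 v0 u0; have p1 := mulr_ile1 v0 u0 v1 u1.
    by apply/andP; split; lra.
  - by rewrite /I subrr addr0 lexx.
  - move=> s' /andP[h1 h2]; rewrite natrD in h2.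
    have -> : s'.2 - (b + l)%:R * c = z + (mu - l%:R * c) + (s'.2 - s.2 - mu).
      by rewrite /z natrD; ring.
    rewrite natrD mulrDr; apply: le_trans (excess_add_le _ zw Gl) _.
    have : (s'.2 - s.2 - mu) ^+ 2 <= l%:R ^+ 2.
      rewrite -[leLHS]real_normK ?num_real // ler_pXn2r ?nnegrE //.
      by rewrite ler_norml; apply/andP; split; lra.
    lra.
rewrite expect_add expect_cst // expect_scale expect_score -/mu -w2.
suff -> : w ^+ 2 - 2 * w * (s.2 + mu) + l%:R ^+ 2 + 2 * w * (s.2 + mu) = w ^+ 2 + l%:R ^+ 2 by [].
ring.
Qed.

Lemma expect_excess_le l c eps B : 0 <= eps ->
  (forall b x, (b < B)%N -> (\sum_i x i = b * l)%N ->
     `|mean_score (b * l) l x - l%:R * c| <= eps * l%:R) ->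
  expect beta score_step 0 (B * l)
    (fun s => excess (eps * (B * l)%:R) (s.2 - (B * l)%:R * c) ^+ 2) (fun=> 0%N, 0) <=
  B%:R * l%:R ^+ 2.
Proof.
move=> eps0; elim: B => [|B IH] H.
  by rewrite /= !mul0r mulr0 subrr /excess normr0 subrr maxxx expr0n.
rewrite mulSn addnC expectD add0n.
apply: (@le_trans _ _ (expect beta score_step 0 (B * l)
    (fun s => excess (eps * (B * l)%:R) (s.2 - (B * l)%:R * c) ^+ 2 + l%:R ^+ 2)
    (fun=> 0%N, 0))).
  apply: (@expect_inv_le _ _ _ beta_ge0 _ _ (fun i s => (\sum_j s.1 j = i)%N)).
  - by move=> i s j /= <-; rewrite sum_pos_step.
  - by rewrite big1.
  - by move=> s /= si; apply: expect_excess_step => //; apply: H.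
rewrite expect_add expect_cst // -natr1 mulrDl mul1r lerD2r.
by apply: IH => b x bB; apply: H; apply: ltnW.
Qed.

(** Chebyshev: a deviation beyond [2 * eps * n] leaves an excess of at least [eps * n] over the
    tolerance, and [B * l^2 / (eps * n)^2] is [1 / (eps^2 * B)] for [n = B * l]. *)
Lemma expect_deviation_le l c eps B : 0 < eps -> (0 < l)%N -> (0 < B)%N ->
  (forall b x, (b < B)%N -> (\sum_i x i = b * l)%N ->
     `|mean_score (b * l) l x - l%:R * c| <= eps * l%:R) ->
  expect beta score_step 0 (B * l)
    (fun s => (2 * eps * (B * l)%:R < `|s.2 - (B * l)%:R * c|)%R%:R) (fun=> 0%N, 0) <=
  (eps ^+ 2 * B%:R)^-1.
Proof.
move=> eps0 l0 B0 H; have lR : 0 < l%:R :> R by rewrite ltr0n.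
have BR : 0 < B%:R :> R by rewrite ltr0n.
set n := (B * l)%N; have nR : 0 < n%:R :> R by rewrite ltr0n muln_gt0 B0.
have en : 0 < (eps * n%:R) ^+ 2 by rewrite exprn_gt0 // mulr_gt0.
rewrite -(ler_pM2l en) -expect_scale.
apply: (@le_trans _ _ (B%:R * l%:R ^+ 2)); last first.
  by rewrite le_eqVlt /n natrM; apply/orP; left; apply/eqP; field; rewrite !gt_eqF.
apply: le_trans (expect_excess_le (ltW eps0) H).
apply: expect_le => // s; rewrite -/n; case: ltP => d; last first.
  by rewrite mulr0 sqr_ge0.
rewrite mulr1 ler_pXn2r ?nnegrE ?excess_ge0 // ?mulr_ge0 ?(ltW eps0) //.
by rewrite /excess le_max; apply/orP; right; lra.
Qed.

End Score.

Local Open Scope classical_set_scope.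

(** * Convergence of the Euler product *)

Section EulerProduct.
Variables (R : realType) (k : nat).
Hypothesis k_gt0 : (0 < k)%N.

Definition euler_partial (N : nat) : R :=
  \prod_(0 <= p < N | prime p) (1 - 2 / p%:R ^+ k).

Lemma euler_factor p : prime p -> 0 <= (1 - 2 / p%:R ^+ k : R) <= 1.
Proof.
move=> pp; have p2 := prime_gt1 pp.
have pk : 2 <= p%:R ^+ k :> R.
  rewrite -natrX ler_nat (leq_trans p2) // -[leqLHS]expn1 leq_pexp2l //.
  exact: ltnW.
have p0 : 0 < p%:R ^+ k :> R by apply: lt_le_trans pk.
by rewrite subr_ge0 ler_pdivrMr // mul1r pk gerBl divr_ge0 // ltW.
Qed.

Lemma euler_partial_bounds N : 0 <= euler_partial N <= 1.
Proof.
elim: N => [|N /andP[h0 h1]]; first by rewrite /euler_partial big_geq // lexx ler01.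
rewrite /euler_partial big_mkcond big_nat_recr //= -big_mkcond -/(euler_partial N).
case: ifP => [pN|_]; last by rewrite mulr1 h0.
by have /andP[f0 f1] := euler_factor pN; rewrite mulr_ge0 //= mulr_ile1.
Qed.

Lemma euler_partial_nonincreasing : nonincreasing_seq euler_partial.
Proof.
apply/nonincreasing_seqP => N.
rewrite /euler_partial [leLHS]big_mkcond big_nat_recr //= -big_mkcond -/(euler_partial N).
case: ifP => [pN|_]; last by rewrite mulr1.
have /andP[f0 f1] := euler_factor pN; have /andP[h0 h1] := euler_partial_bounds N.
by rewrite ler_piMr.
Qed.

Lemma euler_partial_cvg : euler_partial @ \oo --> euler_prod R k.
Proof.
apply: nonincreasing_is_cvgn; first exact: euler_partial_nonincreasing.
by exists 0 => _ [N _ <-]; case/andP: (euler_partial_bounds N).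
Qed.

Lemma euler_prod_bounds : 0 <= euler_prod R k <= 1.
Proof.
apply/andP; split.
  by apply: (limr_ge (cvgP _ euler_partial_cvg)); apply: nearW => N;
    case/andP: (euler_partial_bounds N).
by apply: (limr_le (cvgP _ euler_partial_cvg)); apply: nearW => N;
  case/andP: (euler_partial_bounds N).
Qed.

End EulerProduct.

(** * Limit of the mean score of a block *)

Section MeanScore.
Variables (R : realType) (k : nat) (beta : nat -> 'I_k -> R).
Hypothesis beta_sum : forall i, \sum_j beta i j = 1.
Variable c : R.
Hypothesis c_gt0 : 0 < c.
Hypothesis c_lt1 : c < 1.
Hypothesis beta_ge : forall i j, c <= beta i j.
Variables (j0 j1 : 'I_k).
Hypothesis j01 : j1 != j0.

(** The error splits as [eps / 4] for truncating the product, [eps / 4] for [C], and twice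
    [eps / 8 + eps / 8] for [D / j] and the large primes. *)
Lemma mean_score_close (eps : R) : 0 < eps -> exists2 J, (0 < J)%N &
  forall j a x, (J <= j)%N -> (\sum_i x i = a)%N -> (a + j ^ 10 <= j ^ 20)%N ->
  `|mean_score beta a (j ^ 10) x - (j ^ 10)%:R * euler_prod R k| <=
  eps * (j ^ 10)%:R.
Proof.
move=> eps0; have k0 : (0 < k)%N by apply: leq_ltn_trans (ltn_ord j0).
have /cvgrPdist_le/(_ (eps / 4)) [|N _ HN] := @euler_partial_cvg R k k0.
  by rewrite divr_gt0.
(* The cutoff is fixed before [j], since [C] depends on it. From [M - 1 >= (64 / eps)^2] follows
   [8 / sqrt (M - 1) <= eps / 8]. *)
pose x1 := (64 / eps) ^+ 2; pose M := maxn N (Num.bound x1).+2.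
have M2 : (2 <= M)%N by rewrite leq_max orbC.
have [C HC] := vis_block_mean beta_sum c_gt0 c_lt1 beta_ge j01 M2.
set D := 41 + 1280 / c ^+ 2 in HC.
have D0 : 0 <= D.
  by apply: addr_ge0; [exact: ler0n|apply: divr_ge0; [exact: ler0n|exact: sqr_ge0]].
clearbody D.
pose x2 := 4 * `|C| / eps + 8 * D / eps.
exists (Num.bound x2).+1 => // j a x Jj xa aj.
have jpos : (0 < j)%N by apply: leq_trans Jj.
have jR : 0 < j%:R :> R by rewrite ltr0n.
have a1 : 0 <= 4 * `|C| / eps by rewrite !mulr_ge0 // invr_ge0 ltW.
have a2 : 0 <= 8 * D / eps by rewrite !mulr_ge0 // invr_ge0 ltW.
have jx2 : x2 <= j%:R.
  apply: le_trans (ltW (archi_boundP _)) _; first by rewrite addr_ge0.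
  by rewrite ler_nat ltnW.
have hC : C <= eps / 4 * (j ^ 10)%:R.
  apply: (le_trans (ler_norm _)); apply: (@le_trans _ _ (eps / 4 * j%:R)); last first.
    rewrite ler_wpM2l ?divr_ge0 ?(ltW eps0) // ler_nat -[leqLHS]expn1 leq_pexp2l //.
  have : 4 * `|C| / eps <= j%:R by rewrite (le_trans _ jx2) // lerDl.
  by rewrite ler_pdivrMr //; lra.
have hD : D / j%:R <= eps / 8.
  have : 8 * D / eps <= j%:R by rewrite (le_trans _ jx2) // lerDr.
  by rewrite ler_pdivrMr // ler_pdivrMr //; lra.
have hM : 8 / Num.sqrt (M.-1)%:R <= eps / 8.
  have s1 : 64 / eps <= Num.sqrt (M.-1)%:R.
    rewrite -[leLHS]ger0_norm ?divr_ge0 ?(ltW eps0) // -sqrtr_sqr ler_wsqrtr // -/x1.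
    apply: le_trans (ltW (archi_boundP _)) _; first by rewrite sqr_ge0.
    rewrite ler_nat; apply: (@leq_trans (Num.bound x1).+2.-1) => //.
    by rewrite -!subn1 leq_sub2r // leq_max leqnn orbT.
  have s0 : 0 < Num.sqrt (M.-1)%:R :> R by apply: lt_le_trans s1; rewrite divr_gt0.
  by rewrite ler_pdivrMr //; move: s1; rewrite ler_pdivrMr //; lra.
have hN : `|euler_prod R k - euler_partial R k M| <= eps / 4.
  by apply: HN; rewrite /= leq_max leqnn.
have := HC j a x xa jpos aj; rewrite -/(mean_score _ _ _ _) -/(euler_partial R k M).
set l := (j ^ 10)%:R in hC *; have l0 : 0 <= l by rewrite /l ler0n.
move=> H; have -> (z : R) : z - l * euler_prod R k =
   (z - l * euler_partial R k M) + l * (euler_partial R k M - euler_prod R k) by ring.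
apply: (le_trans (ler_normD _ _)); rewrite normrM (ger0_norm l0) distrC.
rewrite (distrC (euler_partial _ _ _)).
have h1 := ler_wpM2l l0 hN.
have h2 := ler_wpM2l l0 hD.
have h3 := ler_wpM2l l0 hM.
move: H; rewrite distrC mulrDr -!(mulrA 2) => H.
lra.
Qed.

End MeanScore.

(** * Interpolation between consecutive powers *)

Section Interpolation.
Variable R : realType.

(** The right-hand side is the chord over [0, 1] of a convex function. *)
Lemma exprn_1D_le (r : nat) (x : R) : 0 <= x <= 1 ->
  (1 + x) ^+ r <= 1 + (2 ^+ r - 1) * x.
Proof.
case/andP=> x0 x1; elim: r => [|r IH]; first by rewrite !expr0 subrr mul0r addr0.
have A0 : 0 <= 2 ^+ r - 1 :> R by rewrite subr_ge0 exprn_ege1 // ler1n.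
rewrite exprSr [2 ^+ r.+1]exprSr; move: (2 ^+ r) A0 IH => A A0 IH.
have : (1 + x) ^+ r * (1 + x) <= (1 + (A - 1) * x) * (1 + x).
  by rewrite ler_wpM2r // addr_ge0.
have : (A - 1) * x * x <= (A - 1) * x by rewrite ler_piMr // mulr_ge0.
lra.
Qed.

Lemma power_gap r n : (0 < r)%N -> exists j, (j ^ r <= n < j.+1 ^ r)%N.
Proof.
move=> r0; elim: n => [|n [j /andP[jn nj]]]; first by exists 0; rewrite exp0n // exp1n.
move: nj; rewrite leq_eqVlt => /orP[/eqP E|nj]; last first.
  by exists j; rewrite nj andbT ltnW.
by exists j.+1; rewrite E leqnn ltn_exp2r //= ltnSn.
Qed.

(** By monotonicity [S n] lies between the values at the neighbouring [r]-th powers, whose ratio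
    tends to 1. *)
Lemma power_interpolation (r : nat) (S : nat -> R) (c : R) : (0 < r)%N ->
  {homo S : m n / (m <= n)%N >-> m <= n} -> 0 <= c <= 1 ->
  (forall eps, 0 < eps -> exists N, forall j, (N <= j)%N ->
     `|S (j ^ r)%N - (j ^ r)%:R * c| <= eps * (j ^ r)%:R) ->
  forall eps, 0 < eps -> exists N, forall n, (N <= n)%N ->
     `|S n - n%:R * c| <= eps * n%:R.
Proof.
move=> r0 Sm /andP[c0 c1] H eps' eps'0.
(* With [q <= n <= q'] the neighbouring powers, the gap costs [eps * q] and the error at [q'] at
   most [2 * eps * q], because [eps <= 1]. *)
pose eps := Num.min (eps' / 3) 1.
have eps0 : 0 < eps by rewrite lt_min ltr01 divr_gt0.
have eps1 : eps <= 1 by rewrite ge_min lexx orbT.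
have eps3 : eps <= eps' / 3 by rewrite ge_min lexx.
have [N HN] := H _ eps0.
pose K : R := 2 ^+ r - 1.
have K0 : 0 <= K by rewrite subr_ge0 exprn_ege1 // ler1n.
pose J := maxn N (Num.bound (K / eps)).+1.
exists (J ^ r)%N => n Jn; have [j /andP[jn nj]] := power_gap n r0.
have Jj : (J <= j)%N by rewrite -ltnS -(@ltn_exp2r _ _ r) // (leq_ltn_trans Jn).
have jpos : (0 < j)%N by apply: leq_trans Jj; rewrite leq_max orbT.
have jR : 0 < j%:R :> R by rewrite ltr0n.
have Nj : (N <= j)%N by rewrite (leq_trans _ Jj) // leq_max leqnn.
have eta : K / j%:R <= eps.
  rewrite ler_pdivrMr // mulrC -ler_pdivrMr //.
  apply: le_trans (ltW (archi_boundP _)) _; first by rewrite divr_ge0 // ltW.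
  by rewrite ler_nat (leq_trans _ Jj) // leq_max leqnSn orbT.
have grow : (j.+1 ^ r)%:R <= (1 + eps) * (j ^ r)%:R :> R.
  have -> : (j.+1 ^ r)%:R = (1 + j%:R^-1) ^+ r * (j ^ r)%:R :> R.
    rewrite !natrX -exprMn; congr (_ ^+ _).
    by rewrite mulrDl mul1r mulVf ?gt_eqF // natr1.
  rewrite ler_wpM2r //.
  apply: (@le_trans _ _ (1 + K * j%:R^-1)); last by rewrite lerD2l.
  by apply: exprn_1D_le; rewrite invr_ge0 ltW //= invf_le1 // ler1n.
have h1 := HN _ Nj; have h2 := HN _ (leqW Nj).
have s1 := Sm _ _ jn; have s2 := Sm _ _ (ltnW nj).
have n1 : (j ^ r)%:R <= n%:R :> R by rewrite ler_nat.
have n2 : n%:R <= (j.+1 ^ r)%:R :> R by rewrite ler_nat ltnW.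
have q0 : 0 <= (j ^ r)%:R :> R by rewrite ler0n.
move: h1 h2 s1 s2 n1 n2 grow q0.
move: ((j ^ r)%:R : R) ((j.+1 ^ r)%:R : R) (S (j ^ r)%N) (S (j.+1 ^ r)%N) (S n) (n%:R : R).
move=> q q' Sq Sq' Sn m; rewrite !ler_norml => /andP[h1 h1'] /andP[h2 h2'] s1 s2 n1 n2 grow q0.
have m0 : 0 <= m by apply: le_trans n1.
have e1 : 3 * eps * m <= eps' * m by rewrite ler_wpM2r //; lra.
have e2 : (q' - q) * c <= eps * q.
  apply: (@le_trans _ _ (q' - q)); last by lra.
  by rewrite ler_piMr //; lra.
have e3 : eps * q <= eps * m by rewrite ler_wpM2l // ltW.
have e4 : eps * q' <= 2 * (eps * q).
  have : eps * q' <= eps * ((1 + eps) * q) by rewrite ler_wpM2l // ltW.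
  have : eps * (eps * q) <= 1 * (eps * q) by rewrite ler_wpM2r // mulr_ge0 // ltW.
  lra.
have m1 : q * c <= m * c by rewrite ler_wpM2r.
have m2 : m * c <= q' * c by rewrite ler_wpM2r.
by apply/andP; split; lra.
Qed.

End Interpolation.

(** * Almost sure convergence *)

Section Law.
Variables (R : realType) (k : nat) (beta : nat -> 'I_k -> R).
Variables (d : measure_display) (T : measurableType d) (P : probability T R).
Variable W : nat -> T -> 'I_k.
Hypothesis W_meas : forall i j, measurable [set t | W i t = j].
Hypothesis W_law : forall (s : seq nat) (js : nat -> 'I_k), uniq s ->
  P (\big[setI/setT]_(i <- s) [set t | W i t = js i]) =
  (\prod_(i <- s) beta i (js i))%:E.
Variable j0 : 'I_k.

Let prefix_event (w : seq 'I_k) : set T :=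
  \big[setI/setT]_(i <- iota 0 (size w)) [set t | W i t = nth j0 w i].

Let word_prob (w : seq 'I_k) : R := \prod_(i <- iota 0 (size w)) beta i (nth j0 w i).

Let prefix_event_rcons w j :
  prefix_event (rcons w j) = prefix_event w `&` [set t | W (size w) t = j].
Proof.
rewrite /prefix_event size_rcons -addn1 iotaD big_cat /= big_seq1 nth_rcons ltnn eqxx.
congr (_ `&` _); rewrite big_seq [RHS]big_seq; apply: eq_bigr => i.
by rewrite mem_iota add0n => /= iw; rewrite nth_rcons iw.
Qed.

Let word_prob_rcons w j : word_prob (rcons w j) = word_prob w * beta (size w) j.
Proof.
rewrite /word_prob size_rcons -addn1 iotaD big_cat /= big_seq1 nth_rcons ltnn eqxx.
congr (_ * _); rewrite big_seq [RHS]big_seq; apply: eq_bigr => i.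
by rewrite mem_iota add0n => /= iw; rewrite nth_rcons iw.
Qed.

Let prefix_event_meas w : measurable (prefix_event w).
Proof. by apply: bigsetI_measurable => i _; apply: W_meas. Qed.

(** The bridge from the probability space to [expect]. Fixing a prefix [w] lets the induction on [m]
    split the event into disjoint cylinders according to the next letter. *)
Lemma law_from_prefix (S : Type) (st : S -> 'I_k -> S) (Q : S -> bool) s0 m w :
  let A := prefix_event w `&`
    [set t | Q (foldl st s0 (w ++ [seq W i t | i <- iota (size w) m]))] in
  measurable A /\
  P A = (word_prob w *
    expect beta st (size w) m (fun s => (Q s)%:R) (foldl st s0 w))%:E.
Proof.
elim: m w => [|m IH] w /=.
  case Qw : (Q (foldl st s0 w)).
    have -> : prefix_event w `&` [set t | Q (foldl st s0 (w ++ [::]))] = prefix_event w.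
      by apply/seteqP; split => t /=; rewrite cats0 Qw; [case|].
    by rewrite mulr1; split; [apply: prefix_event_meas|rewrite W_law ?iota_uniq].
  have -> : prefix_event w `&` [set t | Q (foldl st s0 (w ++ [::]))] = set0.
    by apply/seteqP; split => t //=; rewrite cats0 Qw => -[].
  by rewrite mulr0 measure0; split; first exact: measurable0.
pose F (j : 'I_k) := prefix_event (rcons w j) `&`
  [set t | Q (foldl st s0 (rcons w j ++ [seq W i t | i <- iota (size w).+1 m]))].
set A := _ `&` _.
have AF : A = \big[setU/set0]_(j < k) F j.
  apply/seteqP; split => t.
    move=> [tw /= tQ]; rewrite (bigD1 (W (size w) t)) //=; left.
    by split; rewrite /= ?prefix_event_rcons // cat_rcons.
  move: t; elim/big_ind: _ => [//|B C BA CA t [/BA|/CA]//|j _ t].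
  by rewrite /F prefix_event_rcons => -[[tw /= <-] tQ]; split=> //=; rewrite -cat_rcons.
have Fm j : measurable (F j).
  by have [] := IH (rcons w j); rewrite size_rcons.
have FP j : P (F j) = (word_prob w * (beta (size w) j *
    expect beta st (size w).+1 m (fun s => (Q s)%:R) (st (foldl st s0 w) j)))%:E.
  have [_] := IH (rcons w j); rewrite size_rcons => ->.
  by rewrite word_prob_rcons foldl_rcons mulrA.
split; first by rewrite AF; apply: bigsetU_measurable.
rewrite AF measure_bigsetU_ord //; last first.
  apply/trivIsetP => i j _ _ /eqP ij; apply/seteqP; split => t //=.
  rewrite /F !prefix_event_rcons => -[[[_ /= Wi] _] [[_ /= Wj] _]].
  by apply: ij; rewrite -Wi -Wj.
by rewrite (eq_bigr _ (fun j _ => FP j)) sumEFin -mulr_sumr.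
Qed.

Lemma law_of_word (S : Type) (st : S -> 'I_k -> S) (Q : S -> bool) s0 n :
  let A := [set t | Q (foldl st s0 [seq W i t | i <- iota 0 n])] in
  measurable A /\ P A = (expect beta st 0 n (fun s => (Q s)%:R) s0)%:E.
Proof.
have := law_from_prefix st Q s0 n [::].
by rewrite /prefix_event /word_prob /= !big_nil setTI mul1r.
Qed.

End Law.

Lemma foldl_score_step (R : realType) (k : nat) (T : Type) (W : nat -> T -> 'I_k) t n :
  foldl (@score_step R k) (fun=> 0%N, 0) [seq W i t | i <- iota 0 n] =
  (walk_pos W n t, \sum_(i < n) Xvis R W i t * Xvis R W i.+1 t).
Proof.
elim: n => [|n IH].
  rewrite /= big_ord0; congr (_, _); apply/funext => j.
  by rewrite /walk_pos big_ord0.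
rewrite -addn1 iotaD map_cat foldl_cat IH /= add0n addn1 big_ord_recr /=.
have walkS : pos_step (walk_pos W n t) (W n t) = walk_pos W n.+1 t.
  by apply/funext => j; rewrite /pos_step /walk_pos big_ord_recr /= eq_sym.
by rewrite /score_step /= walkS.
Qed.

Lemma Xvis_bounds (R : realType) (k : nat) (T : Type) (W : nat -> T -> 'I_k) n t :
  0 <= (Xvis R W n t : R) <= 1.
Proof. by rewrite /Xvis; case: visible; rewrite !(lexx, ler01). Qed.

Lemma score_nondecreasing (R : realType) (k : nat) (T : Type) (W : nat -> T -> 'I_k) t :
  {homo (fun n => \sum_(i < n) Xvis R W i t * Xvis R W i.+1 t : R) :
    m n / (m <= n)%N >-> m <= n}.
Proof.
move=> m n mn; apply: (@ler_sum_ord_widen _ _ _ (fun i => Xvis R W i t * Xvis R W i.+1 t)) => // i.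
by case/andP: (Xvis_bounds R W i t) => ? _; case/andP: (Xvis_bounds R W i.+1 t) => ? _;
  rewrite mulr_ge0.
Qed.

(** The term at time 0 vanishes, as the gcd of the coordinates of the origin is 0. *)
Lemma score_Rbar_avg (R : realType) (k : nat) (T : Type) (W : nat -> T -> 'I_k) t n :
  \sum_(i < n.+1) Xvis R W i t * Xvis R W i.+1 t = n%:R * Rbar_avg R W n t.
Proof.
case: n => [|n].
  rewrite mul0r big_ord_recl big_ord0 addr0.
  rewrite [Xvis R W 0 t](_ : _ = 0) ?mul0r // /Xvis /visible.
  by rewrite big1 // => j _; rewrite /walk_pos big_ord0.
rewrite /Rbar_avg mulVKf ?pnatr_eq0 // big_ord_recl.
rewrite [Xvis R W 0 t](_ : _ = 0) ?mul0r ?add0r; last first.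
  by rewrite /Xvis /visible big1 // => j _; rewrite /walk_pos big_ord0.
by rewrite big_add1 big_mkord.
Qed.

Section AlmostSure.
Variables (R : realType) (k : nat) (beta : nat -> 'I_k -> R).
Hypothesis beta_sum : forall i, \sum_j beta i j = 1.
Variable c : R.
Hypothesis c_gt0 : 0 < c.
Hypothesis c_lt1 : c < 1.
Hypothesis beta_ge : forall i j, c <= beta i j.
Variables (j0 j1 : 'I_k).
Hypothesis j01 : j1 != j0.
Variables (d : measure_display) (T : measurableType d) (P : probability T R).
Variable W : nat -> T -> 'I_k.
Hypothesis W_meas : forall i j, measurable [set t | W i t = j].
Hypothesis W_law : forall (s : seq nat) (js : nat -> 'I_k), uniq s ->
  P (\big[setI/setT]_(i <- s) [set t | W i t = js i]) =
  (\prod_(i <- s) beta i (js i))%:E.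

Let score n t : R := \sum_(i < n) Xvis R W i t * Xvis R W i.+1 t.

Let deviates (eps : R) (j : nat) : set T :=
  [set t | 2 * eps * (j ^ 20)%:R < `|score (j ^ 20) t - (j ^ 20)%:R * euler_prod R k|].

(** Time [j ^ 20] consists of [j ^ 10] blocks of length [j ^ 10]. The resulting bound in [j ^ 10] is
    weakened to a telescoping one, easy to sum. *)
Lemma deviates_prob eps : 0 < eps -> exists J, forall j, (J <= j)%N ->
  measurable (deviates eps j) /\
  (P (deviates eps j) <= ((eps ^+ 2)^-1 * (j.+1%:R^-1 - j.+2%:R^-1))%:E)%E.
Proof.
move=> eps0; have beta_ge0 i j : 0 <= beta i j.
  by apply: le_trans (beta_ge i j); rewrite ltW.
have [J J0 HJ] := mean_score_close beta_sum c_gt0 c_lt1 beta_ge j01 eps0.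
(* Starting after [J] gives [j >= 2], needed for [j.+1 * j.+2 <= (2 * j)^2 <= j^4]. *)
exists J.+1 => j Jj; have jpos : (0 < j)%N by apply: leq_trans Jj.
have j2 : (2 <= j)%N by rewrite (leq_trans _ Jj) // ltnS.
have l0 : (0 < j ^ 10)%N by rewrite expn_gt0 jpos.
have ll : (j ^ 20 = j ^ 10 * j ^ 10)%N by rewrite -expnD.
pose n := (j ^ 10 * j ^ 10)%N.
pose Q (s : ('I_k -> nat) * R) := 2 * eps * n%:R < `|s.2 - n%:R * euler_prod R k|.
have [mA PA] := law_of_word W_meas W_law j0 (@score_step R k) Q (fun=> 0%N, 0) n.
have DA : deviates eps j =
    [set t | Q (foldl (@score_step R k) (fun=> 0%N, 0) [seq W i t | i <- iota 0 n])].
  by apply/seteqP; split => t; rewrite /deviates /Q /= foldl_score_step /= ll.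
split; first by rewrite DA.
rewrite DA PA lee_fin.
apply: le_trans (expect_deviation_le beta_ge0 beta_sum eps0 l0 l0 _) _.
  move=> b x bl xb; apply: HJ => //; first exact: ltnW.
  by rewrite ll addnC -mulSn leq_mul2r bl orbT.
rewrite invfM ler_wpM2l ?invr_ge0 ?sqr_ge0 //.
have j1R : 0 < j.+1%:R :> R by rewrite ltr0n.
have j2R : 0 < j.+2%:R :> R by rewrite ltr0n.
have -> : j.+1%:R^-1 - j.+2%:R^-1 = (j.+1%:R * j.+2%:R)^-1 :> R.
  by rewrite -(natr1 j.+1) in j2R *; field; rewrite !gt_eqF.
rewrite lef_pV2 ?posrE ?mulr_gt0 ?ltr0n // -natrM ler_nat.
apply: (@leq_trans ((2 * j) * (2 * j))); first by rewrite leq_mul //; lia.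
rewrite mulnn expnMn; apply: (@leq_trans (j ^ 2 * j ^ 2)).
  by rewrite leq_mul2r (leq_sqr 2 j) j2 orbT.
by rewrite -expnD leq_pexp2l.
Qed.

(** Borel-Cantelli, the probabilities having partial sums at most [1 / eps^2]. *)
Lemma deviates_finitely_often eps : 0 < eps ->
  P.-negligible [set t | ~ exists N, forall j, (N <= j)%N ->
    `|score (j ^ 20) t - (j ^ 20)%:R * euler_prod R k| <= 2 * eps * (j ^ 20)%:R].
Proof.
move=> eps0; have [J HJ] := deviates_prob eps0.
pose F j : set T := if (J <= j)%N then deviates eps j else set0.
have Fm j : measurable (F j).
  by rewrite /F; case: ifP => [/HJ[]//|_]; apply: measurable0.
pose C : R := (eps ^+ 2)^-1.
have C0 : 0 <= C by rewrite invr_ge0 sqr_ge0.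
have FP j : (P (F j) <= (C * (j.+1%:R^-1 - j.+2%:R^-1))%:E)%E.
  rewrite /F; case: ifP => [/HJ[]//|_]; rewrite measure0 lee_fin mulr_ge0 //.
  by rewrite subr_ge0 lef_pV2 ?posrE ?ltr0n // ler_nat.
have limF : P (lim_sup_set F) = 0%E.
  apply: lim_sup_set_cvg0 => //; apply: (@le_lt_trans _ _ C%:E); last exact: ltry.
  apply: lime_le; first by apply: is_cvg_nneseries => n _ _; apply: measure_ge0.
  apply: nearW => n.
  apply: (@le_trans _ _ (\sum_(0 <= j < n) (C * (j.+1%:R^-1 - j.+2%:R^-1))%:E)%E).
    by apply: lee_sum => j _; apply: FP.
  rewrite sumEFin lee_fin -mulr_sumr ler_piMr //.
  have -> : \sum_(0 <= j < n) (j.+1%:R^-1 - j.+2%:R^-1) = 1 - n.+1%:R^-1 :> R.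
    elim: n => [|n IH]; first by rewrite big_geq // invr1 subrr.
    by rewrite big_nat_recr //= IH addrA subrK.
  by rewrite gerBl invr_ge0.
have mlim : measurable (lim_sup_set F).
  by apply: bigcap_measurable => // i _; apply: bigcup_measurable.
apply: (@negligibleS _ _ _ _ (lim_sup_set F)); last exact/negligibleP.
move=> t /= Ht N _; apply: contrapT => HN; apply: Ht.
exists (maxn N J) => j; rewrite geq_max => /andP[Nj Jj].
rewrite leNgt; apply/negP => dev; apply: HN.
by exists j => //; rewrite /F Jj.
Qed.

(** The tolerances [2 / (r + 1)] give countably many negligible sets; off their union, interpolation
    applies to each trajectory. *)
Lemma Rbar_avg_ae_cvg :
  {ae P, forall t, (fun n => Rbar_avg R W n t) @ \oo --> euler_prod R k}.
Proof.
have k0 : (0 < k)%N by apply: leq_ltn_trans (ltn_ord j0).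
pose bad r := [set t | ~ exists N, forall j, (N <= j)%N ->
    `|score (j ^ 20) t - (j ^ 20)%:R * euler_prod R k| <=
      2 * r.+1%:R^-1 * (j ^ 20)%:R].
have : P.-negligible (\bigcup_r bad r).
  apply: negligible_bigcup => r; apply: deviates_finitely_often.
  by rewrite invr_gt0 ltr0n.
apply: negligibleS => t /= Ht; apply: contrapT => good; apply: Ht.
have {good} good r : exists N, forall j, (N <= j)%N ->
    `|score (j ^ 20) t - (j ^ 20)%:R * euler_prod R k| <=
      2 * r.+1%:R^-1 * (j ^ 20)%:R.
  by apply: contrapT => H; apply: good; exists r.
have cb := euler_prod_bounds R k0.
have H : forall eps, 0 < eps -> exists N, forall n, (N <= n)%N ->
    `|score n t - n%:R * euler_prod R k| <= eps * n%:R.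
  apply: (@power_interpolation R 20 (fun n => score n t)) => //.
    exact: score_nondecreasing.
  move=> eps eps0; have [N HN] := good (Num.bound (2 / eps)).
  exists N => j Nj; apply: le_trans (HN j Nj) _; rewrite ler_wpM2r //.
  rewrite ler_pdivrMr ?ltr0n // mulrC -ler_pdivrMr //.
  apply: le_trans (ltW (archi_boundP _)) _; first by rewrite divr_ge0 // ltW.
  by rewrite ler_nat.
apply/cvgrPdist_le => e e0.
have [N HN] := H (e / 4) (divr_gt0 e0 (ltr0Sn _ _)).
(* The score at [n + 1] equals [n] times the average. The shift by one costs at most [e / 4 + 1],
   and [n >= 2 / e] absorbs the 1 into [e * n / 2]. *)
pose M := maxn N (Num.bound (2 / e)).+1.
exists M => // n /= Mn.
have n0 : (0 < n)%N by apply: leq_trans Mn; rewrite leq_max orbT.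
have nR : 0 < n%:R :> R by rewrite ltr0n.
have Nn : (N <= n.+1)%N by rewrite (leq_trans _ (leqW Mn)) // leq_max leqnn.
have ne : 2 <= e * n%:R.
  rewrite mulrC -ler_pdivrMr //.
  apply: le_trans (ltW (archi_boundP _)) _; first by rewrite divr_ge0 // ltW.
  by rewrite ler_nat (leq_trans _ Mn) // leq_max leqnSn orbT.
have := HN _ Nn; rewrite /score score_Rbar_avg -(natr1 n) => h.
rewrite -(ler_pM2l nR) -[X in X * `|_| <= _](gtr0_norm nR) -normrM mulrBr.
have n1 : 1 <= n%:R :> R by rewrite ler1n.
have en : e <= e * n%:R by rewrite ler_peMr // ltW.
case/andP: cb; move: (euler_prod R k) (Rbar_avg R W n t) h => x y h x0 x1; move: h.
rewrite !ler_norml => /andP[h1 h2]; apply/andP; split; lra.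
Qed.

End AlmostSure.

Theorem theorem1p3 (k q : nat) (hk : (2 <= k)%N) (hq : (1 <= q)%N)
  (R : realType) (alpha : 'I_q -> 'I_k -> R)
  (halpha_pos : forall t j, 0 < alpha t j)
  (halpha_lt1 : forall t j, alpha t j < 1)
  (halpha_sum : forall t, \sum_(j < k) alpha t j = 1)
  (typ : nat -> 'I_q)
  (d : measure_display) (T : measurableType d) (P : probability T R)
  (W : nat -> T -> 'I_k)
  (hWmeas : forall i j, measurable [set t | W i t = j])
  (hWlaw : forall (s : seq nat) (js : nat -> 'I_k), uniq s ->
     P (\big[setI/setT]_(i <- s) [set t | W i t = js i])
     = (\prod_(i <- s) alpha (typ i) (js i))%:E) :
  {ae P, forall t, (fun n => Rbar_avg R W n t) @ \oo --> euler_prod R k}.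
Proof.
(* As all weights lie in (0, 1), their product is a positive lower bound for each of them, uniform
   over the finitely many types. *)
pose c : R := \prod_(p : 'I_q * 'I_k) alpha p.1 p.2.
have c0 : 0 < c by apply: prodr_gt0.
have c_le t j : c <= alpha t j.
  rewrite /c (bigD1 (t, j)) //= ler_piMr ?(ltW (halpha_pos _ _)) //.
  by apply: prodr_ile1 => p _; rewrite !ltW.
have c1 : c < 1.
  exact: le_lt_trans (c_le (Ordinal hq) (Ordinal (ltnW hk))) (halpha_lt1 _ _).
apply: (@Rbar_avg_ae_cvg R k (fun i => alpha (typ i)) _ c c0 c1 _
  (Ordinal (ltnW hk)) (Ordinal hk)) => //.
Qed.
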